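(* Let $b>0$, let $q\in C[-b,b]$ be complex-valued, and let $f\in C^2[-b,b]$ be a solution of $f''-qf=0$ with $f(x)\neq0$ on $[-b,b]$ and $f(0)=1$. Let $\overline{\mathbf{R}}=[-b,b]\times[-b,b]$ and let $u$ be a regular (classical, twice continuously differentiable) complex-valued solution of $$\bigl(\partial_x^2-\partial_t^2-q(x)\bigr)u=0$$ in $\overline{\mathbf{R}}$ such that its Goursat data admit the series expansions $$\tfrac12\bigl(u(x,x)+u(x,-x)\bigr)=c_0u_0(x,x)+\sum_{n=1}^\infty c_nu_{2n-1}(x,x),\qquad \tfrac12\bigl(u(x,x)-u(x,-x)\bigr)=\sum_{n=1}^\infty b_nu_{2n}(x,x),$$ with $c_n,b_n\in\mathbb{C}$, both uniformly convergent on $[-b,b]$. Then for any $(x,t)\in\overline{\mathbf{R}}$, $$u(x,t)=c_0u_0(x,t)+\sum_{n=1}^\infty\bigl(c_nu_{2n-1}(x,t)+b_nu_{2n}(x,t)\bigr),$$ and the series converges uniformly in $\overline{\mathbf{R}}$.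
   Context: The generalized wave polynomials $u_n$ are defined from $f$ as follows. Set $X^{(0)}\equiv\widetilde X^{(0)}\equiv1$ and, for $n\ge1$, $$X^{(n)}(x)=n\int_0^xX^{(n-1)}(s)\bigl(f^2(s)\bigr)^{(-1)^n}ds,\qquad \widetilde X^{(n)}(x)=n\int_0^x\widetilde X^{(n-1)}(s)\bigl(f^2(s)\bigr)^{(-1)^{n-1}}ds.$$ Let $\varphi_k=fX^{(k)}$ for odd $k$ and $\varphi_k=f\widetilde X^{(k)}$ for even $k$. Then $u_0(x,t)=\varphi_0(x)$ and, for $m\ge1$, $$u_{2m-1}(x,t)=\sum_{\text{even }k=0}^m\binom mk\varphi_{m-k}(x)t^k,\qquad u_{2m}(x,t)=\sum_{\text{odd }k=1}^m\binom mk\varphi_{m-k}(x)t^k.$$ *)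

(* Defs.v *)
From Stdlib Require Import Reals Arith Lia.
From Coquelicot Require Import Coquelicot.
Open Scope R_scope.

Definition seg (b x : R) : Prop := - b <= x <= b.

Definition square (b : R) (p : R * R) : Prop := seg b (fst p) /\ seg b (snd p).

(* [is_derive] with the neighbourhood filter of x restricted to D: on a closed
   interval this is the one-sided derivative at the endpoints. *)
Definition is_derive_within (D : R -> Prop) (g : R -> C) (x : R) (l : C) : Prop :=
  filterdiff (K := R_AbsRing) (U := R_NormedModule) (V := C_R_NormedModule)
    g (within D (locally x)) (fun y => scal y l).

Definition is_derive_seg (b : R) (g g' : R -> C) : Prop :=
  forall x, seg b x -> is_derive_within (seg b) g x (g' x).

Definition is_pderiv_x (b : R) (v vx : R -> R -> C) : Prop :=
  forall x t, seg b x -> seg b t ->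
    is_derive_within (seg b) (fun y => v y t) x (vx x t).

Definition is_pderiv_t (b : R) (v vt : R -> R -> C) : Prop :=
  forall x t, seg b x -> seg b t ->
    is_derive_within (seg b) (fun s => v x s) t (vt x t).

Definition continuous_seg (b : R) (g : R -> C) : Prop :=
  continuous_on (T := R_UniformSpace) (U := C_UniformSpace) (seg b) g.

Definition continuous_square (b : R) (v : R -> R -> C) : Prop :=
  continuous_on (T := prod_UniformSpace R_UniformSpace R_UniformSpace)
    (U := C_UniformSpace) (square b) (fun p => v (fst p) (snd p)).

Definition is_C2_schrodinger_solution (b : R) (q f : R -> C) : Prop :=
  exists f1 f2 : R -> C,
    is_derive_seg b f f1 /\ is_derive_seg b f1 f2 /\
    continuous_seg b f /\ continuous_seg b f1 /\ continuous_seg b f2 /\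
    forall x, seg b x -> (f2 x - q x * f x = 0)%C.

Definition is_regular_wave_solution (b : R) (q : R -> C) (u : R -> R -> C) : Prop :=
  exists ux ut uxx uxt utx utt : R -> R -> C,
    is_pderiv_x b u ux /\ is_pderiv_t b u ut /\
    is_pderiv_x b ux uxx /\ is_pderiv_t b ux uxt /\
    is_pderiv_x b ut utx /\ is_pderiv_t b ut utt /\
    continuous_square b u /\ continuous_square b ux /\ continuous_square b ut /\
    continuous_square b uxx /\ continuous_square b uxt /\
    continuous_square b utx /\ continuous_square b utt /\
    forall x t, seg b x -> seg b t ->
      (uxx x t - utt x t - q x * u x t = 0)%C.

(* z raised to the power (-1)^n *)
Definition Cpow_sign (z : C) (n : nat) : C := if Nat.even n then z else (/ z)%C.

Fixpoint Xpow (f : R -> C) (n : nat) (x : R) : C :=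
  match n with
  | O => RtoC 1
  | S m => (RtoC (INR n) *
      RInt (V := C_R_CompleteNormedModule)
        (fun s => Xpow f m s * Cpow_sign (f s ^ 2) n) 0%R x)%C
  end.

Fixpoint Xtpow (f : R -> C) (n : nat) (x : R) : C :=
  match n with
  | O => RtoC 1
  | S m => (RtoC (INR n) *
      RInt (V := C_R_CompleteNormedModule)
        (fun s => Xtpow f m s * Cpow_sign (f s ^ 2) m) 0%R x)%C
  end.

Definition phi (f : R -> C) (k : nat) (x : R) : C :=
  (if Nat.odd k then f x * Xpow f k x else f x * Xtpow f k x)%C.

(* [Binomial.C] is Stdlib's (real-valued) binomial coefficient; unqualified
   [C] is the type of complex numbers. *)
Definition wave_term (f : R -> C) (m : nat) (x t : R) (k : nat) : C :=
  (RtoC (Binomial.C m k) * phi f (m - k)%nat x * RtoC t ^ k)%C.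

(* u_n; for n >= 1, m = floor((n+1)/2) is the index such that n = 2m-1 (n odd)
   or n = 2m (n even). *)
Definition wave_poly (f : R -> C) (n : nat) (x t : R) : C :=
  match n with
  | O => phi f 0 x
  | S _ =>
      let m := Nat.div2 (S n) in
      if Nat.odd n
      then sum_n_m (fun k => if Nat.even k then wave_term f m x t k else RtoC 0) 0 m
      else sum_n_m (fun k => if Nat.odd k then wave_term f m x t k else RtoC 0) 1 m
  end.

Lemma wave_poly_odd_index (f : R -> C) (m : nat) (x t : R) : (1 <= m)%nat ->
  wave_poly f (2 * m - 1) x t =
  sum_n_m (fun k => if Nat.even k then wave_term f m x t k else RtoC 0) 0 m.
Proof.
  intros Hm. destruct m as [|m]; [lia|].
  replace (2 * S m - 1)%nat with (S (2 * m)) by lia.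
  unfold wave_poly. rewrite Nat.odd_succ, Nat.even_mul.
  replace (S (S (2 * m))) with (2 * S m)%nat by lia.
  now rewrite Nat.div2_double.
Qed.

Lemma wave_poly_even_index (f : R -> C) (m : nat) (x t : R) : (1 <= m)%nat ->
  wave_poly f (2 * m) x t =
  sum_n_m (fun k => if Nat.odd k then wave_term f m x t k else RtoC 0) 1 m.
Proof.
  intros Hm. unfold wave_poly.
  destruct (2 * m)%nat as [|n] eqn:E; [lia|].
  rewrite <- E, Nat.odd_mul, Nat.div2_succ_double. reflexivity.
Qed.

Definition CVU_on {T : Type} (D : T -> Prop) (s : nat -> T -> C) (g : T -> C) : Prop :=
  forall eps : R, 0 < eps -> exists N : nat, forall n : nat, (N <= n)%nat ->
    forall x : T, D x -> Cmod (s n x - g x)%C < eps.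

(* Main.v *)
Require Import Defs.
From Stdlib Require Import Reals Lra Lia Psatz.
From Stdlib Require Import ClassicalEpsilon.
From Coquelicot Require Import Coquelicot.
Open Scope R_scope.

(** A regular solution of the wave equation with potential is controlled by its
    Goursat data: a bound [delta] for [|w(x,x)|] and [|w(x,-x)|] on [[-b,b]]
    gives [|w| <= K delta] on the whole square, with [K] depending only on [b]
    and [q] ([goursat_stability]).  The wave polynomials are regular solutions
    ([wave_poly_regular]), so the difference [w] between [u] and a partial sum
    of the expansion is one too.  The polynomials of odd index are even in [t]
    and those of even index are odd in [t], hence on the two diagonals [w] is
    the sum, respectively the difference, of the remainders of the two given
    series.  These tend to zero uniformly, and stability carries the uniform
    convergence from the diagonals to the square.

    Stability is proved in the characteristic coordinates [xi = (x+t)/2],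
    [eta = (x-t)/2], where the equation is [w_{xi eta} = q w] and the Goursat
    data live on the axes; the square becomes the diamond
    [|xi| + |eta| <= b], which contains the rectangle spanned by the origin and
    any of its points.  Hence [w] at a point is the sum of its values at the two
    adjacent corners of this rectangle, minus [w(0,0)], plus the double integral
    of [q w].
    In the norm weighted by [exp (- 4 Q b |xi|)], where [|q| <= Q], the
    contribution of that integral is at most half of the norm of [w], which is
    absorbed.  Only an inequality is needed, and the mean value theorem applied
    twice to real and imaginary parts gives it ([goursat_rectangle]).
    All differentiation there takes place in the open square; the closed one is
    reached by continuity.

    That the wave polynomials solve the equation rests on
    [phi_k'' = q phi_k + k (k-1) phi_{k-2}] ([phi_C2]), which matches
    [(t^k)'' = k (k-1) t^(k-2)]: on a sum of the terms
    [binom(m,k) phi_{m-k}(x) t^k] over [k] of one parity, the operator leaves a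
    telescoping sum ([wave_sum_regular]). *)

(** * Calculus of complex-valued functions on a closed interval *)

Lemma filterlim_Cmod {T : Type} (F : (T -> Prop) -> Prop) {FF : Filter F}
  (g : T -> C) (l : C) :
  filterlim g F (locally (T := C_UniformSpace) l) <->
  forall eps : posreal, F (fun x => Cmod (g x - l)%C < eps).
Proof.
  exact (filterlim_locally_ball_norm (K := C_AbsRing) (U := C_NormedModule) g l).
Qed.

Lemma filterlim_Cplus {T : Type} (F : (T -> Prop) -> Prop) {FF : Filter F}
  (g h : T -> C) (l m : C) :
  filterlim g F (locally (T := C_UniformSpace) l) ->
  filterlim h F (locally (T := C_UniformSpace) m) ->
  filterlim (fun x => g x + h x)%C F (locally (T := C_UniformSpace) (l + m)%C).
Proof.
  intros Hg Hh.
  exact (filterlim_comp_2 g h _ Hg Hh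
    (filterlim_plus (K := C_AbsRing) (V := C_NormedModule) l m)).
Qed.

Lemma filterlim_Cmult {T : Type} (F : (T -> Prop) -> Prop) {FF : Filter F}
  (g h : T -> C) (l m : C) :
  filterlim g F (locally (T := C_UniformSpace) l) ->
  filterlim h F (locally (T := C_UniformSpace) m) ->
  filterlim (fun x => g x * h x)%C F (locally (T := C_UniformSpace) (l * m)%C).
Proof.
  intros Hg Hh.
  assert (Hg' : filterlim g F (locally (T := AbsRing_UniformSpace C_AbsRing) l)).
  { intros P HP. apply Hg, locally_C, HP. }
  exact (filterlim_comp_2 g h _ Hg' Hh
    (filterlim_scal (K := C_AbsRing) (V := C_NormedModule) l m)).
Qed.

Lemma filterlim_Cinv {T : Type} (F : (T -> Prop) -> Prop) {FF : Filter F}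
  (g : T -> C) (l : C) :
  l <> RtoC 0 ->
  filterlim g F (locally (T := C_UniformSpace) l) ->
  filterlim (fun x => / g x)%C F (locally (T := C_UniformSpace) (/ l)%C).
Proof.
  intros Hl Hg. apply filterlim_Cmod; [exact FF|]. intros eps.
  rewrite (filterlim_Cmod F) in Hg.
  assert (Hm : 0 < Cmod l) by now apply Cmod_gt_0.
  assert (Hd : 0 < Rmin (Cmod l / 2) (eps * (Cmod l * Cmod l / 2))).
  { pose proof (cond_pos eps). apply Rmin_glb_lt; [lra|].
    apply Rmult_lt_0_compat; [lra|]. nra. }
  specialize (Hg (mkposreal _ Hd)). simpl in Hg.
  revert Hg. apply filter_imp. intros x Hx.
  pose proof (Rmin_l (Cmod l / 2) (eps * (Cmod l * Cmod l / 2))).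
  pose proof (Rmin_r (Cmod l / 2) (eps * (Cmod l * Cmod l / 2))).
  assert (Hgx : Cmod l / 2 < Cmod (g x)).
  { pose proof (Cmod_triangle (g x) (l - g x)) as Ht.
    replace (g x + (l - g x))%C with l in Ht by ring.
    replace (l - g x)%C with (- (g x - l))%C in Ht by ring.
    rewrite Cmod_opp in Ht. lra. }
  assert (Hg0 : g x <> RtoC 0). { intros E. rewrite E, Cmod_0 in Hgx. lra. }
  replace (/ g x - / l)%C with (- (g x - l) * / (g x * l))%C by (field; auto).
  rewrite Cmod_mult, Cmod_opp, Cmod_inv, Cmod_mult.
  2:{ now apply Cmult_neq_0. }
  apply (Rmult_lt_reg_r (Cmod (g x) * Cmod l)); [nra|].
  rewrite Rmult_assoc, Rinv_l, Rmult_1_r by nra.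
  eapply Rlt_le_trans; [exact Hx|].
  eapply Rle_trans; [eassumption|]. pose proof (cond_pos eps).
  apply Rmult_le_compat_l; nra.
Qed.

Lemma is_filter_lim_within (D : R -> Prop) (x : R) :
  is_filter_lim (within D (locally x)) x.
Proof. intros P HP. unfold within. revert HP. now apply filter_imp. Qed.

Lemma within_proper (D : R -> Prop) (x : R) : D x -> ProperFilter (within D (locally x)).
Proof.
  intros Hx. split; [|apply within_filter, locally_filter].
  intros P HP. exists x. apply (locally_singleton _ _ HP). exact Hx.
Qed.

Lemma norm_C_R (z : C) : norm (V := C_R_NormedModule) z = Cmod z.
Proof.
  unfold norm, Cmod; simpl. unfold prod_norm, norm; simpl. unfold abs; simpl.
  f_equal. rewrite !Rmult_1_r, <- !Rabs_mult, !Rabs_pos_eq; trivial; nra.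
Qed.

Lemma norm_increment (dg l : C) (dx : R) :
  norm (V := C_R_NormedModule)
    (minus (G := C_R_NormedModule) dg (scal (V := C_R_NormedModule) dx l))
  = Cmod (dg - RtoC dx * l)%C.
Proof.
  rewrite norm_C_R. f_equal.
  unfold minus, plus, opp, scal; simpl. unfold prod_scal, prod_plus, scal, prod_opp; simpl.
  unfold mult; simpl.
  apply injective_projections; simpl; unfold plus, opp; simpl; ring.
Qed.

(** Caratheodory's form of the derivative.  It turns sum, product and inverse
    rules into limits of complex functions along one and the same filter,
    whether the point is interior or an endpoint. *)
Lemma is_derive_within_slope (D : R -> Prop) (g : R -> C) (x : R) (l : C) :
  D x ->
  (is_derive_within D g x l <->
   exists h : R -> C,
     filterlim h (within D (locally x)) (locally (T := C_UniformSpace) l) /\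
     forall y, D y -> g y = (g x + RtoC (y - x) * h y)%C).
Proof.
  intros Dx. split.
  - intros [_ H]. specialize (H x (is_filter_lim_within D x)).
    exists (fun y => if Req_EM_T y x then l else ((g y - g x) / RtoC (y - x))%C).
    split.
    + apply filterlim_Cmod; [apply within_filter, locally_filter|].
      intros eps.
      assert (He : 0 < eps / 2) by (pose proof (cond_pos eps); lra).
      specialize (H (mkposreal _ He)). revert H. simpl.
      unfold within. apply filter_imp. intros y Hy Dy. specialize (Hy Dy).
      destruct (Req_EM_T y x) as [_|n].
      * replace (l - l)%C with (RtoC 0) by ring. rewrite Cmod_0. apply cond_pos.
      * assert (Hyx : RtoC (y - x) <> RtoC 0).
        { intros E. apply RtoC_inj in E. lra. }
        assert (E := Rle_trans _ _ _ (Req_le _ _ (eq_sym (norm_increment _ _ _))) Hy).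
        change (norm (minus y x)) with (Rabs (y - x)) in E.
        change (Cmod (g y - g x - RtoC (y - x) * l)%C <= eps / 2 * Rabs (y - x)) in E.
        replace (g y - g x - RtoC (y - x) * l)%C
          with (RtoC (y - x) * ((g y - g x) / RtoC (y - x) - l))%C in E by now field.
        rewrite Cmod_mult, Cmod_R in E.
        assert (0 < Rabs (y - x)) by (apply Rabs_pos_lt; lra).
        assert (Cmod ((g y - g x) / RtoC (y - x) - l) <= eps / 2) by nra.
        pose proof (cond_pos eps). lra.
    + intros y Dy. destruct (Req_EM_T y x) as [->|n].
      * rewrite Rminus_diag. ring.
      * field. intros E. apply RtoC_inj in E. lra.
  - intros [h [Hh Hg]]. split; [exact (is_linear_scal_l (K := R_AbsRing) (V := C_R_NormedModule) l)|].
    intros x' Hx'.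
    assert (x' = x) as ->.
    { pose proof (within_proper D x Dx).
      apply (is_filter_lim_unique (K := R_AbsRing) (V := R_NormedModule)
        (F := within D (locally x))); [exact Hx'|apply is_filter_lim_within]. }
    intros eps. assert (FF : Filter (within D (locally x))) by apply within_filter, locally_filter.
    rewrite (filterlim_Cmod _ h l) in Hh.
    specialize (Hh eps). revert Hh.
    unfold within. apply filter_imp. intros y Hy Dy. specialize (Hy Dy).
    eapply Rle_trans; [right; apply norm_increment|].
    change (Cmod (g y - g x - RtoC (y - x) * l)%C <= eps * Rabs (y - x)).
    replace (g y - g x - RtoC (y - x) * l)%C with (RtoC (y - x) * (h y - l))%C
      by (rewrite (Hg y Dy); ring).
    rewrite Cmod_mult, Cmod_R, Rmult_comm.
    apply Rmult_le_compat_r; [apply Rabs_pos|lra].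
Qed.

Lemma is_derive_within_filterlim (D : R -> Prop) (g : R -> C) (x : R) (l : C) :
  D x -> is_derive_within D g x l ->
  filterlim g (within D (locally x)) (locally (T := C_UniformSpace) (g x)).
Proof.
  intros Dx H.
  apply (filterdiff_continuous_aux (K := R_AbsRing) (U := R_NormedModule)
     (V := C_R_NormedModule)); [|apply is_filter_lim_within].
  eexists; exact H.
Qed.

Lemma is_derive_within_ext (D : R -> Prop) (g h : R -> C) (x : R) (l m : C) :
  D x -> (forall y, D y -> g y = h y) -> l = m ->
  is_derive_within D g x l -> is_derive_within D h x m.
Proof.
  intros Dx E <-. rewrite !is_derive_within_slope by exact Dx.
  intros [k [Hk Hg]]. exists k; split; [exact Hk|].
  intros y Dy. rewrite <- !E by assumption. auto.
Qed.

Lemma is_derive_within_const (D : R -> Prop) (a : C) (x : R) :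
  D x -> is_derive_within D (fun _ => a) x (RtoC 0).
Proof.
  intros Dx. apply is_derive_within_slope; [exact Dx|].
  exists (fun _ => RtoC 0). split; [apply filterlim_const|]. intros; ring.
Qed.

Lemma is_derive_within_id (D : R -> Prop) (x : R) :
  D x -> is_derive_within D RtoC x (RtoC 1).
Proof.
  intros Dx. apply is_derive_within_slope; [exact Dx|].
  exists (fun _ => RtoC 1). split; [apply filterlim_const|].
  intros y _. rewrite RtoC_minus. ring.
Qed.

Lemma is_derive_within_plus (D : R -> Prop) (g h : R -> C) (x : R) (l m : C) :
  D x -> is_derive_within D g x l -> is_derive_within D h x m ->
  is_derive_within D (fun y => g y + h y)%C x (l + m)%C.
Proof.
  intros Dx. rewrite !is_derive_within_slope by exact Dx.
  intros [g' [Lg Hg]] [h' [Lh Hh]].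
  exists (fun y => g' y + h' y)%C. split.
  - apply filterlim_Cplus; auto. apply within_filter, locally_filter.
  - intros y Dy. rewrite (Hg y Dy), (Hh y Dy). ring.
Qed.

Lemma is_derive_within_mult (D : R -> Prop) (g h : R -> C) (x : R) (l m : C) :
  D x -> is_derive_within D g x l -> is_derive_within D h x m ->
  is_derive_within D (fun y => g y * h y)%C x (l * h x + g x * m)%C.
Proof.
  intros Dx Dg Dh. pose proof (is_derive_within_filterlim _ _ _ _ Dx Dh) as Ch.
  revert Dg Dh. rewrite !is_derive_within_slope by exact Dx.
  intros [g' [Lg Hg]] [h' [Lh Hh]].
  assert (FF : Filter (within D (locally x))) by apply within_filter, locally_filter.
  exists (fun y => g' y * h y + g x * h' y)%C. split.
  - apply filterlim_Cplus; auto; apply filterlim_Cmult; auto. apply filterlim_const.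
  - intros y Dy. rewrite (Hg y Dy), (Hh y Dy). ring.
Qed.

Lemma is_derive_within_inv (D : R -> Prop) (g : R -> C) (x : R) (l : C) :
  D x -> (forall y, D y -> g y <> RtoC 0) -> is_derive_within D g x l ->
  is_derive_within D (fun y => / g y)%C x (- l / (g x * g x))%C.
Proof.
  intros Dx Hn Dg. pose proof (is_derive_within_filterlim _ _ _ _ Dx Dg) as Cg.
  revert Dg. rewrite !is_derive_within_slope by exact Dx.
  intros [g' [Lg Hg]].
  assert (FF : Filter (within D (locally x))) by apply within_filter, locally_filter.
  exists (fun y => RtoC (-1) * g' y * / (g y * g x))%C. split.
  - replace (- l / (g x * g x))%C with (RtoC (-1) * l * / (g x * g x))%C
      by (unfold Cdiv; ring).
    apply (filterlim_Cmult _ (fun y => RtoC (-1) * g' y)%C).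
    { apply (filterlim_Cmult _ (fun _ => RtoC (-1)) g'); [apply filterlim_const|exact Lg]. }
    apply filterlim_Cinv; [exact FF| |].
    + apply Cmult_neq_0; auto.
    + apply filterlim_Cmult; auto. apply filterlim_const.
  - intros y Dy. assert (E := Hg y Dy).
    assert (E' : (RtoC (y - x) * g' y)%C = (g y - g x)%C) by (rewrite E; ring).
    transitivity (/ g x - (RtoC (y - x) * g' y) * / (g y * g x))%C; [|ring].
    rewrite E'. field. auto.
Qed.

(** The retraction onto the segment: composing with it extends a function that
    is continuous on the segment to one continuous on the line, to which the
    fundamental theorem of calculus applies at every point. *)
Definition clamp (b x : R) : R := Rmax (- b) (Rmin b x).

Lemma clamp_in (b x : R) : 0 <= b -> seg b (clamp b x).
Proof.
  intros Hb. unfold seg, clamp, Rmax, Rmin.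
  destruct (Rle_dec b x), (Rle_dec _ _); lra.
Qed.

Lemma clamp_id (b x : R) : seg b x -> clamp b x = x.
Proof.
  unfold seg, clamp, Rmax, Rmin. intros H.
  destruct (Rle_dec b x), (Rle_dec _ _); lra.
Qed.

Lemma clamp_lipschitz (b x y : R) : 0 <= b -> Rabs (clamp b y - clamp b x) <= Rabs (y - x).
Proof.
  intros Hb. unfold clamp, Rmax, Rmin, Rabs.
  repeat (destruct (Rle_dec _ _) || destruct (Rcase_abs _)); lra.
Qed.

Lemma continuous_clamp (b : R) (g : R -> C) : 0 <= b -> continuous_seg b g ->
  forall x, continuous (U := C_R_CompleteNormedModule) (fun y => g (clamp b y)) x.
Proof.
  intros Hb Hg x P HP.
  destruct (Hg _ (clamp_in b x Hb) P HP) as [d Hd].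
  exists d. intros y Hy. apply Hd; [|apply clamp_in, Hb].
  eapply Rle_lt_trans; [apply clamp_lipschitz, Hb|exact Hy].
Qed.

(** The integrand and its clamped extension have the same integral from [0] to
    any point of the segment, and the derivative of the latter restricts to the
    one-sided derivatives at the endpoints. *)
Lemma is_derive_seg_RInt (b : R) (g : R -> C) : 0 < b -> continuous_seg b g ->
  is_derive_seg b (fun x => RInt (V := C_R_CompleteNormedModule) g 0 x) g.
Proof.
  intros Hb Hg x Hx.
  set (G := fun y => g (clamp b y)).
  apply (is_derive_within_ext _
    (fun x => RInt (V := C_R_CompleteNormedModule) G 0 x) _ _ (G x)); [exact Hx| | |].
  - intros y Hy. apply (RInt_ext (V := C_R_CompleteNormedModule)). intros z Hz. unfold G. f_equal.
    apply clamp_id. unfold seg in *. revert Hz; unfold Rmin, Rmax.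
    destruct (Rle_dec 0 y); lra.
  - unfold G. now rewrite clamp_id.
  - apply (filterdiff_locally (K := R_AbsRing) (U := R_NormedModule)
      (V := C_R_NormedModule) (F := within (seg b) (locally x)) (FF := within_proper _ _ Hx) _ x); [apply is_filter_lim_within|].
    apply (is_derive_RInt (V := C_R_NormedModule) G _ 0 x).
    + apply filter_forall. intros y.
      apply (RInt_correct (V := C_R_CompleteNormedModule)).
      apply ex_RInt_continuous. intros z _. apply continuous_clamp; [lra|exact Hg].
    + apply continuous_clamp; [lra|exact Hg].
Qed.

(** * The wave operator on twice differentiable functions *)

Lemma is_derive_seg_continuous (b : R) (g g' : R -> C) :
  is_derive_seg b g g' -> continuous_seg b g.
Proof. intros H x Hx. exact (is_derive_within_filterlim _ _ _ _ Hx (H x Hx)). Qed.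

Lemma continuous_seg_mult (b : R) (g h : R -> C) :
  continuous_seg b g -> continuous_seg b h ->
  continuous_seg b (fun x => g x * h x)%C.
Proof.
  intros Hg Hh x Hx. apply filterlim_Cmult; auto.
  apply within_filter, locally_filter.
Qed.

Lemma continuous_seg_plus (b : R) (g h : R -> C) :
  continuous_seg b g -> continuous_seg b h ->
  continuous_seg b (fun x => g x + h x)%C.
Proof.
  intros Hg Hh x Hx. apply filterlim_Cplus; auto.
  apply within_filter, locally_filter.
Qed.

Lemma continuous_seg_const (b : R) (a : C) : continuous_seg b (fun _ => a).
Proof. intros x Hx. apply filterlim_const. Qed.

Lemma continuous_seg_inv (b : R) (g : R -> C) :
  (forall x, seg b x -> g x <> RtoC 0) ->
  continuous_seg b g -> continuous_seg b (fun x => / g x)%C.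
Proof.
  intros Hn Hg x Hx. apply filterlim_Cinv; auto.
  apply within_filter, locally_filter.
Qed.

Lemma continuous_square_mult (b : R) (v w : R -> R -> C) :
  continuous_square b v -> continuous_square b w ->
  continuous_square b (fun x t => v x t * w x t)%C.
Proof.
  intros Hv Hw p Hp.
  apply (filterlim_Cmult _ (fun p => v (fst p) (snd p)) (fun p => w (fst p) (snd p)));
    [exact (Hv p Hp)|exact (Hw p Hp)].
Qed.

Lemma continuous_square_plus (b : R) (v w : R -> R -> C) :
  continuous_square b v -> continuous_square b w ->
  continuous_square b (fun x t => v x t + w x t)%C.
Proof.
  intros Hv Hw p Hp.
  apply (filterlim_Cplus _ (fun p => v (fst p) (snd p)) (fun p => w (fst p) (snd p)));
    [exact (Hv p Hp)|exact (Hw p Hp)].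
Qed.

Lemma continuous_square_const (b : R) (a : C) : continuous_square b (fun _ _ => a).
Proof. intros p Hp. apply filterlim_const. Qed.

Lemma continuous_square_fst (b : R) (g : R -> C) :
  continuous_seg b g -> continuous_square b (fun x _ => g x).
Proof.
  intros Hg p [Hx Ht] P HP. destruct (Hg _ Hx P HP) as [d Hd].
  exists d. intros r [Hr _] [Hr1 _]. exact (Hd _ Hr Hr1).
Qed.

Lemma continuous_square_snd (b : R) (g : R -> C) :
  continuous_seg b g -> continuous_square b (fun _ t => g t).
Proof.
  intros Hg p [Hx Ht] P HP. destruct (Hg _ Ht P HP) as [d Hd].
  exists d. intros r [_ Hr] [_ Hr1]. exact (Hd _ Hr Hr1).
Qed.

Lemma continuous_square_ext (b : R) (v w : R -> R -> C) :
  (forall x t, seg b x -> seg b t -> v x t = w x t) ->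
  continuous_square b v -> continuous_square b w.
Proof.
  intros E. apply continuous_on_ext. intros p [Hx Ht]. now apply E.
Qed.

Ltac split_ands := repeat match goal with |- _ /\ _ => split end.

(** The right-hand side [g] is kept free because a single term
    [phi_{m-k}(x) t^k] is not a solution: only the residues of the terms of a
    wave polynomial add up to [q u]. *)
Definition dalembert (b : R) (v g : R -> R -> C) : Prop :=
  exists vx vt vxx vxt vtx vtt : R -> R -> C,
    (is_pderiv_x b v vx /\ is_pderiv_t b v vt /\
     is_pderiv_x b vx vxx /\ is_pderiv_t b vx vxt /\
     is_pderiv_x b vt vtx /\ is_pderiv_t b vt vtt) /\
    (continuous_square b v /\ continuous_square b vx /\ continuous_square b vt /\
     continuous_square b vxx /\ continuous_square b vxt /\
     continuous_square b vtx /\ continuous_square b vtt) /\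
    forall x t, seg b x -> seg b t -> (vxx x t - vtt x t = g x t)%C.

Lemma regular_dalembert (b : R) (q : R -> C) (u : R -> R -> C) :
  is_regular_wave_solution b q u <-> dalembert b u (fun x t => q x * u x t)%C.
Proof.
  split.
  - intros (ux & ut & uxx & uxt & utx & utt & H).
    destruct H as (H1 & H2 & H3 & H4 & H5 & H6 & H7 & H8 & H9 & H10 & H11 & H12 & H13 & E).
    exists ux, ut, uxx, uxt, utx, utt. split_ands; try assumption.
    intros x t Hx Ht.
    replace (uxx x t - utt x t)%C with (uxx x t - utt x t - q x * u x t + q x * u x t)%C by ring.
    rewrite E by assumption. ring.
  - intros (ux & ut & uxx & uxt & utx & utt & (H1 & H2 & H3 & H4 & H5 & H6) & (H7 & H8 & H9 & H10 & H11 & H12 & H13) & E).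
    exists ux, ut, uxx, uxt, utx, utt. repeat (split; [assumption|]).
    intros x t Hx Ht. rewrite E by assumption. ring.
Qed.

Lemma is_pderiv_x_comb (b : R) (a : C) (v vx w wx : R -> R -> C) :
  is_pderiv_x b v vx -> is_pderiv_x b w wx ->
  is_pderiv_x b (fun x t => a * v x t + w x t)%C (fun x t => a * vx x t + wx x t)%C.
Proof.
  intros Hv Hw x t Hx Ht.
  apply (is_derive_within_ext _ (fun y => a * v y t + w y t)%C _ _
    (RtoC 0 * v x t + a * vx x t + wx x t)%C); [exact Hx|auto|ring|].
  apply is_derive_within_plus; [exact Hx| |now apply Hw].
  apply (is_derive_within_mult _ (fun _ => a) (fun y => v y t));
    [exact Hx|now apply is_derive_within_const|now apply Hv].
Qed.

Lemma is_pderiv_t_comb (b : R) (a : C) (v vt w wt : R -> R -> C) :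
  is_pderiv_t b v vt -> is_pderiv_t b w wt ->
  is_pderiv_t b (fun x t => a * v x t + w x t)%C (fun x t => a * vt x t + wt x t)%C.
Proof.
  intros Hv Hw x t Hx Ht.
  exact (is_pderiv_x_comb b a (fun t x => v x t) (fun t x => vt x t)
    (fun t x => w x t) (fun t x => wt x t)
    (fun t x Ht Hx => Hv x t Hx Ht) (fun t x Ht Hx => Hw x t Hx Ht) t x Ht Hx).
Qed.

Lemma continuous_square_comb (b : R) (a : C) (v w : R -> R -> C) :
  continuous_square b v -> continuous_square b w ->
  continuous_square b (fun x t => a * v x t + w x t)%C.
Proof.
  intros Hv Hw. apply continuous_square_plus; [|exact Hw].
  apply continuous_square_mult; [apply continuous_square_const|exact Hv].
Qed.

Lemma dalembert_comb (b : R) (a : C) (v g w h : R -> R -> C) :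
  dalembert b v g -> dalembert b w h ->
  dalembert b (fun x t => a * v x t + w x t)%C (fun x t => a * g x t + h x t)%C.
Proof.
  intros (vx & vt & vxx & vxt & vtx & vtt & (H1 & H2 & H3 & H4 & H5 & H6)
    & (H7 & H8 & H9 & H10 & H11 & H12 & H13) & E)
    (wx & wt & wxx & wxt & wtx & wtt & (K1 & K2 & K3 & K4 & K5 & K6)
    & (K7 & K8 & K9 & K10 & K11 & K12 & K13) & F).
  exists (fun x t => a * vx x t + wx x t)%C, (fun x t => a * vt x t + wt x t)%C,
    (fun x t => a * vxx x t + wxx x t)%C, (fun x t => a * vxt x t + wxt x t)%C,
    (fun x t => a * vtx x t + wtx x t)%C, (fun x t => a * vtt x t + wtt x t)%C.
  split; [|split].
  - split_ands; (apply is_pderiv_x_comb || apply is_pderiv_t_comb); assumption.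
  - split_ands; apply continuous_square_comb; assumption.
  - intros x t Hx Ht. rewrite <- E, <- F by assumption. ring.
Qed.

Lemma dalembert_ext (b : R) (v g w h : R -> R -> C) :
  (forall x t, seg b x -> seg b t -> v x t = w x t) ->
  (forall x t, seg b x -> seg b t -> g x t = h x t) ->
  dalembert b v g -> dalembert b w h.
Proof.
  intros Ev Eg (vx & vt & vxx & vxt & vtx & vtt & (H1 & H2 & H3)
    & (H4 & H5) & E).
  exists vx, vt, vxx, vxt, vtx, vtt. split; [|split].
  - split; [|split; [|exact H3]].
    + intros x t Hx Ht.
      apply (is_derive_within_ext _ (fun y => v y t) _ _ (vx x t)); auto.
    + intros x t Hx Ht.
      apply (is_derive_within_ext _ (fun s => v x s) _ _ (vt x t)); auto.
  - split; [|exact H5]. revert H4. now apply continuous_square_ext.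
  - intros x t Hx Ht. rewrite E, Eg by assumption. reflexivity.
Qed.

Lemma dalembert_zero (b : R) : dalembert b (fun _ _ => RtoC 0) (fun _ _ => RtoC 0).
Proof.
  exists (fun _ _ => RtoC 0), (fun _ _ => RtoC 0), (fun _ _ => RtoC 0),
    (fun _ _ => RtoC 0), (fun _ _ => RtoC 0), (fun _ _ => RtoC 0).
  split; [|split].
  - split_ands; intros x t Hx Ht; now apply is_derive_within_const.
  - split_ands; apply continuous_square_const.
  - intros. ring.
Qed.

Lemma dalembert_sum (b : R) (v g : nat -> R -> R -> C) (n m : nat) :
  (forall k, (n <= k <= m)%nat -> dalembert b (v k) (g k)) ->
  dalembert b (fun x t => sum_n_m (fun k => v k x t) n m : C)
    (fun x t => sum_n_m (fun k => g k x t) n m : C).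
Proof.
  assert (Hempty : forall m, (m < n)%nat ->
    dalembert b (fun x t => sum_n_m (fun k => v k x t) n m : C)
      (fun x t => sum_n_m (fun k => g k x t) n m : C)).
  { intros p Hp. apply (dalembert_ext _ (fun _ _ => RtoC 0) (fun _ _ => RtoC 0));
      [| |apply dalembert_zero]; intros; symmetry;
      exact (sum_n_m_zero (G := C_AbelianMonoid) _ _ _ Hp). }
  induction m as [|m IH]; intros H.
  - destruct n as [|n]; [|apply Hempty; lia].
    apply (dalembert_ext _ (v 0%nat) (g 0%nat)); [| |apply H; lia];
      intros; symmetry; exact (sum_n_n (G := C_AbelianMonoid) _ 0).
  - destruct (Nat.le_gt_cases n (S m)) as [Hn|Hn]; [|now apply Hempty].
    apply (dalembert_ext _
      (fun x t => RtoC 1 * v (S m) x t + sum_n_m (fun k => v k x t) n m)%C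
      (fun x t => RtoC 1 * g (S m) x t + sum_n_m (fun k => g k x t) n m)%C).
    + intros x t _ _. rewrite (sum_n_Sm (G := C_AbelianMonoid)) by exact Hn.
      change (@plus C_AbelianMonoid) with Cplus. ring.
    + intros x t _ _. rewrite (sum_n_Sm (G := C_AbelianMonoid)) by exact Hn.
      change (@plus C_AbelianMonoid) with Cplus. ring.
    + apply dalembert_comb; [apply H; lia|].
      apply IH. intros k Hk. apply H. lia.
Qed.

Definition C2_seg (b : R) (a a2 : R -> C) : Prop :=
  exists a1, is_derive_seg b a a1 /\ is_derive_seg b a1 a2 /\ continuous_seg b a2.

Lemma is_derive_within_scal_r (D : R -> Prop) (g : R -> C) (x : R) (l a : C) :
  D x -> is_derive_within D g x l ->
  is_derive_within D (fun y => g y * a)%C x (l * a)%C.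
Proof.
  intros Dx Hg. apply (is_derive_within_ext _ (fun y => g y * a)%C _ _ (l * a + g x * RtoC 0)%C);
    [exact Dx|auto|ring|].
  apply (is_derive_within_mult _ g (fun _ => a)); auto. now apply is_derive_within_const.
Qed.

Lemma is_derive_within_scal_l (D : R -> Prop) (g : R -> C) (x : R) (l a : C) :
  D x -> is_derive_within D g x l ->
  is_derive_within D (fun y => a * g y)%C x (a * l)%C.
Proof.
  intros Dx Hg. apply (is_derive_within_ext _ (fun y => g y * a)%C _ _ (l * a)%C);
    [exact Dx|intros; ring|ring|].
  now apply is_derive_within_scal_r.
Qed.

Lemma dalembert_separated (b : R) (a a2 s s2 : R -> C) :
  C2_seg b a a2 -> C2_seg b s s2 ->
  dalembert b (fun x t => a x * s t)%C (fun x t => a2 x * s t - a x * s2 t)%C.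
Proof.
  intros (a1 & Ha & Ha1 & Ca2) (s1 & Hs & Hs1 & Cs2).
  exists (fun x t => a1 x * s t)%C, (fun x t => a x * s1 t)%C,
    (fun x t => a2 x * s t)%C, (fun x t => a1 x * s1 t)%C,
    (fun x t => a1 x * s1 t)%C, (fun x t => a x * s2 t)%C.
  split; [|split; [|reflexivity]].
  - split_ands; intros x t Hx Ht.
    + exact (is_derive_within_scal_r _ _ _ _ (s t) Hx (Ha x Hx)).
    + exact (is_derive_within_scal_l _ _ _ _ (a x) Ht (Hs t Ht)).
    + exact (is_derive_within_scal_r _ _ _ _ (s t) Hx (Ha1 x Hx)).
    + exact (is_derive_within_scal_l _ _ _ _ (a1 x) Ht (Hs t Ht)).
    + exact (is_derive_within_scal_r _ _ _ _ (s1 t) Hx (Ha x Hx)).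
    + exact (is_derive_within_scal_l _ _ _ _ (a x) Ht (Hs1 t Ht)).
  - pose proof (is_derive_seg_continuous _ _ _ Ha).
    pose proof (is_derive_seg_continuous _ _ _ Ha1).
    pose proof (is_derive_seg_continuous _ _ _ Hs).
    pose proof (is_derive_seg_continuous _ _ _ Hs1).
    assert (Hprod : forall g h, continuous_seg b g -> continuous_seg b h ->
      continuous_square b (fun x t => g x * h t)%C).
    { intros g h Hg Hh. apply continuous_square_mult;
        [now apply continuous_square_fst|now apply continuous_square_snd]. }
    split_ands; apply Hprod; assumption.
Qed.

Lemma regular_sum (b : R) (q : R -> C) (v : nat -> R -> R -> C) (n m : nat) :
  (forall k, (n <= k <= m)%nat -> is_regular_wave_solution b q (v k)) ->
  is_regular_wave_solution b q (fun x t => sum_n_m (fun k => v k x t) n m : C).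
Proof.
  intros H. apply regular_dalembert.
  apply (dalembert_ext _ (fun x t => sum_n_m (fun k => v k x t) n m : C)
    (fun x t => sum_n_m (fun k => q x * v k x t)%C n m : C)); [reflexivity| |].
  - intros x t _ _. exact (sum_n_m_mult_l (K := C_Ring) (q x) (fun k => v k x t) n m).
  - apply (dalembert_sum b v (fun k x t => q x * v k x t)%C). intros k Hk. now apply regular_dalembert, H.
Qed.

Lemma regular_comb (b : R) (q : R -> C) (a : C) (v w : R -> R -> C) :
  is_regular_wave_solution b q v -> is_regular_wave_solution b q w ->
  is_regular_wave_solution b q (fun x t => a * v x t + w x t)%C.
Proof.
  rewrite !regular_dalembert. intros Hv Hw.
  apply (dalembert_ext _ (fun x t => a * v x t + w x t)%C
    (fun x t => a * (q x * v x t) + q x * w x t)%C).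
  - reflexivity.
  - intros x t _ _. ring.
  - now apply (dalembert_comb b a v (fun x t => q x * v x t)%C w (fun x t => q x * w x t)%C).
Qed.

Lemma regular_ext (b : R) (q : R -> C) (v w : R -> R -> C) :
  (forall x t, v x t = w x t) ->
  is_regular_wave_solution b q v -> is_regular_wave_solution b q w.
Proof.
  intros E. rewrite !regular_dalembert. apply dalembert_ext; intros; now rewrite E.
Qed.

Lemma regular_scal (b : R) (q : R -> C) (a : C) (v : R -> R -> C) :
  is_regular_wave_solution b q v ->
  is_regular_wave_solution b q (fun x t => a * v x t)%C.
Proof.
  intros Hv. apply (regular_ext _ _ (fun x t => (a - 1) * v x t + v x t)%C).
  - intros. ring.
  - now apply regular_comb.
Qed.

(** * The generalized wave polynomials *)

Lemma is_derive_seg_pow (b : R) (k : nat) :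
  is_derive_seg b (fun t => RtoC t ^ k)%C (fun t => RtoC (INR k) * RtoC t ^ (k - 1))%C.
Proof.
  intros x Hx. induction k as [|k IH].
  - apply (is_derive_within_ext _ (fun _ => RtoC 1) _ _ (RtoC 0));
      [exact Hx|reflexivity|simpl; ring|now apply is_derive_within_const].
  - apply (is_derive_within_ext _ (fun t => RtoC t * RtoC t ^ k)%C _ _
      (RtoC 1 * RtoC x ^ k + RtoC x * (RtoC (INR k) * RtoC x ^ (k - 1)))%C);
      [exact Hx|reflexivity| |].
    + rewrite S_INR, RtoC_plus. destruct k as [|k]; [simpl; ring|].
      replace (S (S k) - 1)%nat with (S k) by lia.
      replace (S k - 1)%nat with k by lia. simpl Cpow. ring.
    + apply is_derive_within_mult; [exact Hx|now apply is_derive_within_id|exact IH].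
Qed.

Lemma C2_seg_pow (b : R) (k : nat) :
  C2_seg b (fun t => RtoC t ^ k)%C
    (fun t => RtoC (INR k * INR (k - 1)) * RtoC t ^ (k - 2))%C.
Proof.
  exists (fun t => RtoC (INR k) * RtoC t ^ (k - 1))%C. split; [|split].
  - apply is_derive_seg_pow.
  - intros x Hx.
    apply (is_derive_within_ext _ (fun t => RtoC (INR k) * RtoC t ^ (k - 1))%C _ _
      (RtoC (INR k) * (RtoC (INR (k - 1)) * RtoC x ^ (k - 1 - 1)))%C);
      [exact Hx|reflexivity| |].
    + rewrite RtoC_mult. replace (k - 1 - 1)%nat with (k - 2)%nat by lia. ring.
    + apply is_derive_within_scal_l; [exact Hx|now apply is_derive_seg_pow].
  - apply continuous_seg_mult; [apply continuous_seg_const|].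
    exact (is_derive_seg_continuous _ _ _ (is_derive_seg_pow b (k - 2))).
Qed.

(** With [Y = own_power] and [Z = dual_power], the two families of iterated
    integrals obey the parity-free rules [Y_{n+1}' = (n+1) Z_n / f^2] and
    [Z_{n+1}' = (n+1) Y_n f^2], and [phi_k = f Y_k]. *)
Definition own_power (f : R -> C) (n : nat) : R -> C :=
  if Nat.odd n then Xpow f n else Xtpow f n.

Definition dual_power (f : R -> C) (n : nat) : R -> C :=
  if Nat.odd n then Xtpow f n else Xpow f n.

Lemma phi_own_power (f : R -> C) (k : nat) (x : R) :
  phi f k x = (f x * own_power f k x)%C.
Proof. unfold phi, own_power. now destruct (Nat.odd k). Qed.

Section FormalPowers.

Variables (b : R) (f : R -> C).
Hypotheses (hb : 0 < b) (f_cont : continuous_seg b f)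
  (f_neq0 : forall x, seg b x -> f x <> RtoC 0).

Lemma continuous_Cpow_sign (n : nat) :
  continuous_seg b (fun s => Cpow_sign (f s ^ 2)%C n).
Proof.
  assert (Hsq : continuous_seg b (fun s => f s ^ 2)%C).
  { simpl. apply continuous_seg_mult; [exact f_cont|].
    apply continuous_seg_mult; [exact f_cont|apply continuous_seg_const]. }
  unfold Cpow_sign. destruct (Nat.even n); [exact Hsq|].
  apply continuous_seg_inv; [|exact Hsq].
  intros x Hx. simpl. rewrite Cmult_1_r. apply Cmult_neq_0; auto.
Qed.

Lemma is_derive_seg_primitive (a : C) (g : R -> C) : continuous_seg b g ->
  is_derive_seg b (fun x => a * RInt (V := C_R_CompleteNormedModule) g 0 x)%C
    (fun x => a * g x)%C.
Proof.
  intros Hg x Hx.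
  apply (is_derive_within_scal_l _ (fun x => RInt (V := C_R_CompleteNormedModule) g 0 x));
    [exact Hx|].
  exact (is_derive_seg_RInt b g hb Hg x Hx).
Qed.

Lemma Xpow_derive (n : nat) :
  continuous_seg b (Xpow f n) /\
  is_derive_seg b (Xpow f (S n))
    (fun x => RtoC (INR (S n)) * (Xpow f n x * Cpow_sign (f x ^ 2) (S n)))%C.
Proof.
  assert (Hstep : forall n, continuous_seg b (Xpow f n) ->
    is_derive_seg b (Xpow f (S n))
      (fun x => RtoC (INR (S n)) * (Xpow f n x * Cpow_sign (f x ^ 2) (S n)))%C).
  { intros m Hm.
    apply (is_derive_seg_primitive _ (fun x => Xpow f m x * Cpow_sign (f x ^ 2) (S m))%C).
    apply continuous_seg_mult; [exact Hm|apply continuous_Cpow_sign]. }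
  assert (Hc : continuous_seg b (Xpow f n)).
  { induction n as [|n IH]; [apply continuous_seg_const|].
    exact (is_derive_seg_continuous _ _ _ (Hstep n IH)). }
  auto.
Qed.

Lemma Xtpow_derive (n : nat) :
  continuous_seg b (Xtpow f n) /\
  is_derive_seg b (Xtpow f (S n))
    (fun x => RtoC (INR (S n)) * (Xtpow f n x * Cpow_sign (f x ^ 2) n))%C.
Proof.
  assert (Hstep : forall n, continuous_seg b (Xtpow f n) ->
    is_derive_seg b (Xtpow f (S n))
      (fun x => RtoC (INR (S n)) * (Xtpow f n x * Cpow_sign (f x ^ 2) n))%C).
  { intros m Hm.
    apply (is_derive_seg_primitive _ (fun x => Xtpow f m x * Cpow_sign (f x ^ 2) m)%C).
    apply continuous_seg_mult; [exact Hm|apply continuous_Cpow_sign]. }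
  assert (Hc : continuous_seg b (Xtpow f n)).
  { induction n as [|n IH]; [apply continuous_seg_const|].
    exact (is_derive_seg_continuous _ _ _ (Hstep n IH)). }
  auto.
Qed.

Lemma own_power_derive (n : nat) :
  is_derive_seg b (own_power f (S n))
    (fun x => RtoC (INR (S n)) * (dual_power f n x * / (f x ^ 2)))%C.
Proof.
  unfold own_power, dual_power. rewrite Nat.odd_succ, <- Nat.negb_odd.
  destruct (Xpow_derive n) as [_ HX], (Xtpow_derive n) as [_ HXt].
  unfold Cpow_sign in HX, HXt. rewrite Nat.even_succ in HX.
  rewrite <- Nat.negb_odd in HXt.
  destruct (Nat.odd n); simpl in *; assumption.
Qed.

Lemma dual_power_derive (n : nat) :
  is_derive_seg b (dual_power f (S n))
    (fun x => RtoC (INR (S n)) * (own_power f n x * f x ^ 2))%C.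
Proof.
  unfold own_power, dual_power. rewrite Nat.odd_succ, <- Nat.negb_odd.
  destruct (Xpow_derive n) as [_ HX], (Xtpow_derive n) as [_ HXt].
  unfold Cpow_sign in HX, HXt. rewrite Nat.even_succ in HX.
  rewrite <- Nat.negb_odd in HXt.
  destruct (Nat.odd n); simpl in *; assumption.
Qed.

End FormalPowers.

(** From [phi_k = f Y_k] one gets [phi_k' = f' Y_k + k Z_{k-1} / f]; in the
    derivative of this the two terms [k f' Z_{k-1} / f^2] cancel, which leaves
    [f'' Y_k + k (k-1) f Y_{k-2}], and [f'' = q f].  For [k = 0, 1] the
    coefficient [k (k-1)] vanishes, so the truncated index [k - 2] is
    harmless. *)
Lemma phi_C2 (b : R) (q f : R -> C) (k : nat) :
  0 < b -> continuous_seg b q -> is_C2_schrodinger_solution b q f ->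
  (forall x, seg b x -> f x <> RtoC 0) ->
  C2_seg b (phi f k)
    (fun x => q x * phi f k x + RtoC (INR k * INR (k - 1)) * phi f (k - 2) x)%C.
Proof.
  intros hb Cq (f1 & f2 & Hf & Hf1 & Cf & Cf1 & Cf2 & Hq) Hn.
  assert (Ef2 : forall x, seg b x -> f2 x = (q x * f x)%C).
  { intros x Hx. replace (f2 x) with (f2 x - q x * f x + q x * f x)%C by ring.
    rewrite Hq by exact Hx. ring. }
  assert (Hown : forall n, continuous_seg b (own_power f n)).
  { intros [|n]; [exact (continuous_seg_const b (RtoC 1))|].
    exact (is_derive_seg_continuous _ _ _ (own_power_derive b f hb Cf Hn n)). }
  assert (Cphi : forall n, continuous_seg b (phi f n)).
  { intros n x Hx. assert (H := continuous_seg_mult _ _ _ Cf (Hown n) x Hx). simpl in H.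
    rewrite <- phi_own_power in H. revert H. apply filterlim_ext.
    intros y. symmetry. apply phi_own_power. }
  assert (Cres : continuous_seg b (fun x => q x * phi f k x
    + RtoC (INR k * INR (k - 1)) * phi f (k - 2) x)%C).
  { apply continuous_seg_plus; apply continuous_seg_mult;
      [exact Cq|apply Cphi|apply continuous_seg_const|apply Cphi]. }
  destruct k as [|k].
  { exists f1. split; [|split; [|exact Cres]].
    - intros x Hx. apply (is_derive_within_ext _ f _ _ (f1 x)); auto.
      intros y _. unfold phi. simpl. ring.
    - intros x Hx. apply (is_derive_within_ext _ f1 _ _ (f2 x)); auto.
      rewrite Ef2 by exact Hx. unfold phi. simpl. rewrite Rmult_0_l. ring. }
  assert (Hinv := fun x Hx => is_derive_within_inv _ f x _ Hx Hn (Hf x Hx)).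
  assert (Hphi : is_derive_seg b (phi f (S k)) (fun x =>
    f1 x * own_power f (S k) x + RtoC (INR (S k)) * (dual_power f k x * / f x))%C).
  { intros x Hx.
    apply (is_derive_within_ext _ (fun y => f y * own_power f (S k) y)%C _ _
      (f1 x * own_power f (S k) x
       + f x * (RtoC (INR (S k)) * (dual_power f k x * / (f x ^ 2))))%C);
      [exact Hx|intros; symmetry; apply phi_own_power| |].
    - specialize (Hn x Hx). simpl Cpow. field. exact Hn.
    - apply is_derive_within_mult; [exact Hx|now apply Hf|].
      now apply (own_power_derive b f hb Cf Hn k). }
  exists (fun x =>
    f1 x * own_power f (S k) x + RtoC (INR (S k)) * (dual_power f k x * / f x))%C.
  split; [exact Hphi|split; [|exact Cres]]. clear Hphi Cres.
  assert (Hdual : is_derive_seg b (dual_power f k)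
    (fun x => RtoC (INR k) * (own_power f (k - 1) x * f x ^ 2))%C).
  { intros x Hx. destruct k as [|k].
    - apply (is_derive_within_ext _ (fun _ => RtoC 1) _ _ (RtoC 0));
        [exact Hx|reflexivity|simpl; ring|now apply is_derive_within_const].
    - replace (S k - 1)%nat with k by lia.
      now apply (dual_power_derive b f hb Cf Hn k). }
  intros x Hx.
  apply (is_derive_within_ext _ (fun x =>
    f1 x * own_power f (S k) x + RtoC (INR (S k)) * (dual_power f k x * / f x))%C _ _
    ((f2 x * own_power f (S k) x
       + f1 x * (RtoC (INR (S k)) * (dual_power f k x * / (f x ^ 2))))
     + RtoC (INR (S k)) * (RtoC (INR k) * (own_power f (k - 1) x * f x ^ 2) * / f x
         + dual_power f k x * (- f1 x / (f x * f x))))%C); [exact Hx|reflexivity| |].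
  - rewrite !phi_own_power, Ef2, RtoC_mult by exact Hx.
    replace (S k - 1)%nat with k by lia. replace (S k - 2)%nat with (k - 1)%nat by lia.
    specialize (Hn x Hx). simpl Cpow. field. exact Hn.
  - apply is_derive_within_plus; [exact Hx| |].
    + apply is_derive_within_mult; [exact Hx|now apply Hf1|].
      now apply (own_power_derive b f hb Cf Hn k).
    + apply is_derive_within_scal_l; [exact Hx|].
      apply (is_derive_within_mult _ (dual_power f k) (fun x => / f x)%C); [exact Hx|now apply Hdual|now apply Hinv].
Qed.

Lemma binomial_shift (m k : nat) : (k + 2 <= m)%nat ->
  Binomial.C m (k + 2) * (INR (k + 2) * INR (k + 1)) =
  Binomial.C m k * (INR (m - k) * INR (m - k - 1)).
Proof.
  intros H. replace m with (k + 2 + (m - k - 2))%nat by lia.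
  generalize (m - k - 2)%nat as p. intros p. unfold Binomial.C.
  replace (k + 2 + p - (k + 2))%nat with p by lia.
  replace (k + 2 + p - k)%nat with (S (S p)) by lia.
  replace (k + 2)%nat with (S (S k)) by lia.
  replace (k + 1)%nat with (S k) by lia.
  replace (S (S p) - 1)%nat with (S p) by lia.
  rewrite !(fact_simpl (S _)), !(fact_simpl k), !(fact_simpl p), !mult_INR.
  pose proof (INR_fact_neq_0 k). pose proof (INR_fact_neq_0 p).
  assert (forall n, INR (S n) <> 0) by (intros; apply not_0_INR; lia).
  field. repeat split; auto.
Qed.

(** Equations between complex numbers that are typed in the carrier of an
    algebraic structure, as big sums are, must be retyped for [ring]. *)
Ltac ring_C := match goal with |- @eq _ ?x ?y => change (@eq C x y) end; ring.

Lemma sum_telescope_2 (T : nat -> C) (m : nat) :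
  sum_n_m (fun k => T (k + 2)%nat - T k)%C 0 m = (T (m + 2)%nat + T (m + 1)%nat - T 1%nat - T 0%nat)%C.
Proof.
  induction m as [|m IH].
  - rewrite (sum_n_n (G := C_AbelianMonoid)). simpl. ring_C.
  - rewrite (sum_n_Sm (G := C_AbelianMonoid)) by lia.
    change (@plus C_AbelianMonoid) with Cplus. rewrite IH.
    replace (S m + 2)%nat with (m + 3)%nat by lia.
    replace (S m + 1)%nat with (m + 2)%nat by lia.
    replace (S m) with (m + 1)%nat by lia. ring_C.
Qed.

(** The weights [a] have period two because the operator connects the term [k]
    with the term [k + 2] only.  Writing [T_k] for the second [t]-derivative of
    the term [k], [v_xx - v_tt] of the term [k] is [q] times the term plus
    [T_{k+2} - T_k], with [T_0 = T_1 = 0] and [T_k = 0] for [k > m]. *)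
Lemma wave_sum_regular (b : R) (q f : R -> C) (a : nat -> C) (m : nat) :
  0 < b -> continuous_seg b q -> is_C2_schrodinger_solution b q f ->
  (forall x, seg b x -> f x <> RtoC 0) ->
  (forall k, a (k + 2)%nat = a k) ->
  is_regular_wave_solution b q
    (fun x t => sum_n_m (fun k => a k * wave_term f m x t k)%C 0 m).
Proof.
  intros hb Cq Hf Hn Ha. apply regular_dalembert.
  (* The cut at [m] is explicit since [Binomial.C m k] does not vanish for [k > m]. *)
  set (T := fun x t k => if (k <=? m)%nat then
    (a k * RtoC (Binomial.C m k * (INR k * INR (k - 1))) * phi f (m - k) x
      * RtoC t ^ (k - 2))%C else RtoC 0).
  apply (dalembert_ext _
    (fun x t => sum_n_m (fun k => (a k * RtoC (Binomial.C m k)) * (phi f (m - k) x * RtoC t ^ k) + RtoC 0)%C 0 m : C)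
    (fun x t => sum_n_m (fun k => (a k * RtoC (Binomial.C m k)) *
       ((q x * phi f (m - k) x + RtoC (INR (m - k) * INR (m - k - 1)) * phi f (m - k - 2) x)
          * RtoC t ^ k
        - phi f (m - k) x * (RtoC (INR k * INR (k - 1)) * RtoC t ^ (k - 2))) + RtoC 0)%C 0 m : C)).
  - intros x t _ _. apply (sum_n_m_ext_loc (G := C_AbelianMonoid)). intros k _.
    unfold wave_term. ring_C.
  - intros x t _ _.
    transitivity (sum_n_m (fun k => q x * (a k * wave_term f m x t k)
        + (T x t (k + 2)%nat - T x t k))%C 0 m : C).
    + apply (sum_n_m_ext_loc (G := C_AbelianMonoid)). intros k [_ Hk].
      assert (E1 : T x t k = (a k * RtoC (Binomial.C m k * (INR k * INR (k - 1)))
        * phi f (m - k) x * RtoC t ^ (k - 2))%C).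
      { unfold T. now rewrite (proj2 (Nat.leb_le _ _) Hk). }
      assert (E2 : T x t (k + 2)%nat =
        (a k * RtoC (Binomial.C m k * (INR (m - k) * INR (m - k - 1)))
          * phi f (m - k - 2) x * RtoC t ^ k)%C).
      { unfold T. destruct (Nat.leb_spec (k + 2) m) as [Hk2|Hk2].
        - rewrite Ha. replace (k + 2 - 1)%nat with (k + 1)%nat by lia.
          rewrite binomial_shift by exact Hk2.
          replace (m - (k + 2))%nat with (m - k - 2)%nat by lia.
          replace (k + 2 - 2)%nat with k by lia. reflexivity.
        - assert (E0 : INR (m - k) * INR (m - k - 1) = 0).
          { destruct (Nat.eq_dec k m) as [->|].
            - rewrite Nat.sub_diag. simpl. ring.
            - replace (m - k - 1)%nat with 0%nat by lia. simpl. ring. }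
          rewrite E0, Rmult_0_r. ring_C. }
      rewrite E1, E2. unfold wave_term. rewrite !RtoC_mult. ring_C.
    + rewrite (sum_n_m_plus (G := C_AbelianMonoid)).
      rewrite (sum_n_m_mult_l (K := C_Ring) (q x) (fun k => a k * wave_term f m x t k)%C).
      change (@plus C_AbelianMonoid) with Cplus. change (@mult C_Ring) with Cmult.
      rewrite sum_telescope_2.
      assert (E1 : forall p, T x t (m + S p)%nat = RtoC 0).
      { intros p. unfold T. destruct (Nat.leb_spec (m + S p) m); [lia|reflexivity]. }
      assert (E2 : T x t 0%nat = RtoC 0).
      { unfold T. simpl. rewrite Rmult_0_l, Rmult_0_r. ring_C. }
      assert (E3 : T x t 1%nat = RtoC 0).
      { unfold T. destruct (1 <=? m)%nat; [|reflexivity].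
        change (INR (1 - 1)) with 0. now rewrite !Rmult_0_r, Cmult_0_r, !Cmult_0_l. }
      rewrite (E1 1%nat), (E1 0%nat), E2, E3.
      replace (0 + 0 - 0 - 0)%C with (RtoC 0) by ring.
      rewrite Cplus_0_r. reflexivity.
  - apply (dalembert_sum b
      (fun k x t => (a k * RtoC (Binomial.C m k)) * (phi f (m - k) x * RtoC t ^ k) + RtoC 0)%C
      (fun k x t => (a k * RtoC (Binomial.C m k)) *
       ((q x * phi f (m - k) x + RtoC (INR (m - k) * INR (m - k - 1)) * phi f (m - k - 2) x)
          * RtoC t ^ k
        - phi f (m - k) x * (RtoC (INR k * INR (k - 1)) * RtoC t ^ (k - 2))) + RtoC 0)%C).
    intros k _.
    apply (dalembert_comb b _ (fun x t => phi f (m - k) x * RtoC t ^ k)%C _ (fun _ _ => RtoC 0) (fun _ _ => RtoC 0));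
      [|apply dalembert_zero].
    exact (dalembert_separated b _ _ _ _
      (phi_C2 b q f (m - k) hb Cq Hf Hn) (C2_seg_pow b k)).
Qed.

Definition parity_weight (e : bool) : C := if e then RtoC 1 else RtoC 0.

Lemma wave_poly_odd_sum (f : R -> C) (m : nat) (x t : R) : (1 <= m)%nat ->
  wave_poly f (2 * m - 1) x t =
  sum_n_m (fun k => parity_weight (Nat.even k) * wave_term f m x t k)%C 0 m.
Proof.
  intros Hm. rewrite wave_poly_odd_index by exact Hm.
  apply (sum_n_m_ext_loc (G := C_AbelianMonoid)). intros k _.
  destruct (Nat.even k); simpl; ring_C.
Qed.

Lemma wave_poly_even_sum (f : R -> C) (m : nat) (x t : R) : (1 <= m)%nat ->
  wave_poly f (2 * m) x t =
  sum_n_m (fun k => parity_weight (Nat.odd k) * wave_term f m x t k)%C 0 m.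
Proof.
  intros Hm. rewrite wave_poly_even_index by exact Hm.
  rewrite (sum_Sn_m (G := C_AbelianMonoid) _ 0 m) by lia.
  change (@plus C_AbelianMonoid) with Cplus. simpl (parity_weight (Nat.odd 0)).
  rewrite Cmult_0_l, Cplus_0_l.
  apply (sum_n_m_ext_loc (G := C_AbelianMonoid)). intros k _.
  destruct (Nat.odd k); simpl; ring_C.
Qed.

(** This is [(-t)^k = (-1)^k t^k], with the sign written as a difference of
    parity weights so that it cancels against the weight of the sum. *)
Lemma wave_term_opp (f : R -> C) (m k : nat) (x t : R) :
  wave_term f m x (- t) k =
  (parity_weight (Nat.even k) * wave_term f m x t k
   - parity_weight (Nat.odd k) * wave_term f m x t k)%C.
Proof.
  unfold wave_term.
  assert (E : (RtoC (- t) ^ k =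
    (parity_weight (Nat.even k) - parity_weight (Nat.odd k)) * RtoC t ^ k)%C).
  { induction k as [|k IH]; [simpl; ring_C|].
    rewrite Nat.even_succ, Nat.odd_succ. simpl Cpow. rewrite IH, RtoC_opp. ring_C. }
  rewrite E. ring_C.
Qed.

Lemma wave_poly_odd_opp (f : R -> C) (m : nat) (x t : R) : (1 <= m)%nat ->
  wave_poly f (2 * m - 1) x (- t) = wave_poly f (2 * m - 1) x t.
Proof.
  intros Hm. rewrite !wave_poly_odd_sum by exact Hm.
  apply (sum_n_m_ext_loc (G := C_AbelianMonoid)). intros k _.
  rewrite wave_term_opp, <- Nat.negb_odd. destruct (Nat.odd k); simpl; ring_C.
Qed.

Lemma wave_poly_even_opp (f : R -> C) (m : nat) (x t : R) : (1 <= m)%nat ->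
  wave_poly f (2 * m) x (- t) = (- wave_poly f (2 * m) x t)%C.
Proof.
  intros Hm. rewrite !wave_poly_even_sum by exact Hm.
  transitivity (RtoC (-1) * sum_n_m (fun k => parity_weight (Nat.odd k) * wave_term f m x t k)%C 0 m)%C; [|ring_C].
  transitivity (sum_n_m (fun k => RtoC (-1) * (parity_weight (Nat.odd k) * wave_term f m x t k))%C 0 m : C);
    [|exact (sum_n_m_mult_l (K := C_Ring) (RtoC (-1)) (fun k => parity_weight (Nat.odd k) * wave_term f m x t k)%C 0 m)].
  apply (sum_n_m_ext_loc (G := C_AbelianMonoid)). intros k _.
  rewrite wave_term_opp, <- Nat.negb_odd. destruct (Nat.odd k); simpl; ring_C.
Qed.

Lemma wave_poly_regular (b : R) (q f : R -> C) (n : nat) :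
  0 < b -> continuous_seg b q -> is_C2_schrodinger_solution b q f ->
  (forall x, seg b x -> f x <> RtoC 0) ->
  is_regular_wave_solution b q (wave_poly f n).
Proof.
  intros hb Cq Hf Hn.
  assert (Hev : forall k, Nat.even (k + 2) = Nat.even k).
  { intros k. now rewrite Nat.add_comm. }
  assert (Hod : forall k, Nat.odd (k + 2) = Nat.odd k).
  { intros k. now rewrite Nat.add_comm. }
  destruct n as [|n].
  - apply (regular_ext _ _ (fun x t => sum_n_m (fun k => RtoC 1 * wave_term f 0 x t k)%C 0 0)).
    + intros x t. rewrite (sum_n_n (G := C_AbelianMonoid)).
      unfold wave_term, Binomial.C. simpl. rewrite Rmult_1_r, Rdiv_1_r. ring_C.
    + apply wave_sum_regular; auto.
  - destruct (Nat.Even_or_Odd n) as [[m ->]|[m ->]].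
    + apply (regular_ext _ _ (fun x t => sum_n_m (fun k => parity_weight (Nat.even k) * wave_term f (S m) x t k)%C 0 (S m))).
      * intros x t. rewrite <- wave_poly_odd_sum by lia. f_equal. lia.
      * apply (wave_sum_regular b q f (fun k => parity_weight (Nat.even k))); auto.
        intros k. now rewrite Hev.
    + apply (regular_ext _ _ (fun x t => sum_n_m (fun k => parity_weight (Nat.odd k) * wave_term f (S m) x t k)%C 0 (S m))).
      * intros x t. rewrite <- wave_poly_even_sum by lia. f_equal. lia.
      * apply (wave_sum_regular b q f (fun k => parity_weight (Nat.odd k))); auto.
        intros k. now rewrite Hod.
Qed.

(** * The wave equation in characteristic coordinates *)

Definition open_square (b x t : R) : Prop := Rabs x < b /\ Rabs t < b.

Lemma open_square_near (b x t : R) : open_square b x t ->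
  exists d : posreal, forall y s,
    Rabs (y - x) < d -> Rabs (s - t) < d -> open_square b y s.
Proof.
  intros [Hx Ht].
  assert (Hd : 0 < Rmin (b - Rabs x) (b - Rabs t)).
  { apply Rmin_glb_lt; lra. }
  exists (mkposreal _ Hd); simpl; intros y s Hy Hs.
  pose proof (Rmin_l (b - Rabs x) (b - Rabs t)).
  pose proof (Rmin_r (b - Rabs x) (b - Rabs t)).
  split.
  - replace y with (x + (y - x)) by ring.
    eapply Rle_lt_trans; [apply Rabs_triang|lra].
  - replace s with (t + (s - t)) by ring.
    eapply Rle_lt_trans; [apply Rabs_triang|lra].
Qed.

(** Differentiability along oblique lines is what passing from the partial
    derivatives in [x] and [t] to those in [xi] and [eta] requires. *)
Lemma derive_along_line (b : R) (v vx vt : R -> R -> R) (x t sx st r : R) :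
  (forall x t, open_square b x t -> is_derive (fun y => v y t) x (vx x t)) ->
  (forall x t, open_square b x t -> is_derive (fun s => v x s) t (vt x t)) ->
  (forall x t, open_square b x t -> continuity_2d_pt vx x t) ->
  open_square b (x + r * sx) (t + r * st) ->
  is_derive (fun r => v (x + r * sx) (t + r * st)) r
    (vx (x + r * sx) (t + r * st) * sx + vt (x + r * sx) (t + r * st) * st).
Proof.
  intros Dx Dt Cx Hr.
  apply is_derive_Reals.
  apply (derivable_pt_lim_comp_2d v (fun r => x + r * sx) (fun r => t + r * st)).
  - apply filterdiff_differentiable_pt_lim.
    apply (is_derive_filterdiff v _ _ vx).
    + apply (locally_2d_locally (fun y s => is_derive (fun z => v z s) y (vx y s))).
      destruct (open_square_near _ _ _ Hr) as [d Hd].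
      exists d; intros y s Hy Hs. apply Dx, Hd; assumption.
    + apply Dt, Hr.
    + apply continuity_2d_pt_filterlim, Cx, Hr.
  - apply is_derive_Reals. auto_derive; trivial; ring.
  - apply is_derive_Reals. auto_derive; trivial; ring.
Qed.

Lemma mixed_derivatives_agree (b : R) (v vx vt vxt vtx : R -> R -> R) (x t : R) :
  (forall x t, open_square b x t -> is_derive (fun y => v y t) x (vx x t)) ->
  (forall x t, open_square b x t -> is_derive (fun s => v x s) t (vt x t)) ->
  (forall x t, open_square b x t -> is_derive (fun s => vx x s) t (vxt x t)) ->
  (forall x t, open_square b x t -> is_derive (fun y => vt y t) x (vtx x t)) ->
  (forall x t, open_square b x t -> continuity_2d_pt vxt x t) ->
  (forall x t, open_square b x t -> continuity_2d_pt vtx x t) ->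
  open_square b x t -> vxt x t = vtx x t.
Proof.
  intros Dx Dt Dxt Dtx Cxt Ctx Hxt.
  assert (Etx : forall x t, open_square b x t ->
     is_derive (fun z => Derive (fun s => v z s) t) x (vtx x t)).
  { intros x0 t0 H0. apply (is_derive_ext_loc (fun y => vt y t0)); [|now apply Dtx].
    destruct (open_square_near _ _ _ H0) as [d Hd].
    exists d; intros y Hy. symmetry; apply is_derive_unique, Dt, Hd; [exact Hy|].
    rewrite Rminus_diag, Rabs_R0; apply cond_pos. }
  assert (Ext : forall x t, open_square b x t ->
     is_derive (fun z => Derive (fun y => v y z) x) t (vxt x t)).
  { intros x0 t0 H0. apply (is_derive_ext_loc (fun s => vx x0 s)); [|now apply Dxt].
    destruct (open_square_near _ _ _ H0) as [d Hd].
    exists d; intros y Hy. symmetry; apply is_derive_unique, Dx, Hd; [|exact Hy].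
    rewrite Rminus_diag, Rabs_R0; apply cond_pos. }
  rewrite <- (is_derive_unique _ _ _ (Etx x t Hxt)).
  rewrite <- (is_derive_unique _ _ _ (Ext x t Hxt)).
  destruct (open_square_near _ _ _ Hxt) as [d Hd].
  symmetry; apply Schwarz.
  - exists d; intros y s Hy Hs; specialize (Hd y s Hy Hs).
    repeat split; eexists; [apply Dx | apply Dt | apply Etx | apply Ext]; exact Hd.
  - apply (continuity_2d_pt_ext_loc vtx); [|now apply Ctx].
    exists d; intros y s Hy Hs. symmetry; apply is_derive_unique, Etx, Hd; assumption.
  - apply (continuity_2d_pt_ext_loc vxt); [|now apply Cxt].
    exists d; intros y s Hy Hs. symmetry; apply is_derive_unique, Ext, Hd; assumption.
Qed.

(** Integrating the bound on [g'] in the form of the mean value theorem: each of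
    the functions [e g - K exp (lam s) / lam] with [e = 1, -1] is decreasing. *)
Lemma increment_le_exp_pos (g g' : R -> R) (K lam a : R) :
  0 < lam -> 0 <= a ->
  (forall s, 0 <= s <= a -> is_derive g s (g' s)) ->
  (forall s, 0 <= s <= a -> Rabs (g' s) <= K * exp (lam * s)) ->
  Rabs (g a - g 0) <= K * (exp (lam * a) - 1) / lam.
Proof.
  intros Hl Ha Hg Hb.
  assert (Hsgn : forall e, e = 1 \/ e = -1 ->
    e * (g a - g 0) <= K * (exp (lam * a) - 1) / lam).
  { intros e He.
    destruct (MVT_gen (fun s => e * g s - K * exp (lam * s) / lam) 0 a
               (fun s => e * g' s - K * exp (lam * s))) as [c [Hc Heq]].
    - rewrite Rmin_left, Rmax_right by lra. intros s Hs.
      apply @is_derive_minus.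
      + apply is_derive_scal, Hg; lra.
      + auto_derive; trivial. field. lra.
    - rewrite Rmin_left, Rmax_right by lra. intros s Hs.
      apply continuity_pt_minus.
      + apply continuity_pt_mult; [apply continuity_pt_const; now intros ? ?|].
        apply derivable_continuous_pt. exists (g' s). apply is_derive_Reals, Hg; lra.
      + apply derivable_continuous_pt. exists (K * exp (lam * s)).
        apply is_derive_Reals. auto_derive; trivial. field. lra.
    - rewrite Rmin_left, Rmax_right in Hc by lra.
      specialize (Hb c Hc). apply Rabs_le_between in Hb.
      rewrite Rmult_0_r, exp_0 in Heq.
      assert (e * g' c - K * exp (lam * c) <= 0) by (destruct He; subst; lra).
      assert ((e * g' c - K * exp (lam * c)) * (a - 0) <= 0) by nra.
      replace (K * (exp (lam * a) - 1) / lam)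
        with (K * exp (lam * a) / lam - K * 1 / lam) by (field; lra).
      lra. }
  apply Rabs_le. split.
  - pose proof (Hsgn (-1) (or_intror eq_refl)). lra.
  - pose proof (Hsgn 1 (or_introl eq_refl)). lra.
Qed.

Lemma increment_le_exp (g g' : R -> R) (K lam a : R) :
  0 < lam ->
  (forall s, Rabs s <= Rabs a -> is_derive g s (g' s)) ->
  (forall s, Rabs s <= Rabs a -> Rabs (g' s) <= K * exp (lam * Rabs s)) ->
  Rabs (g a - g 0) <= K * (exp (lam * Rabs a) - 1) / lam.
Proof.
  intros Hl Hg Hb.
  destruct (Rle_or_lt 0 a) as [Ha|Ha].
  - rewrite (Rabs_pos_eq a Ha) in *.
    apply (increment_le_exp_pos g g'); auto.
    + intros s Hs. apply Hg. rewrite Rabs_pos_eq; lra.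
    + intros s Hs. rewrite <- (Rabs_pos_eq s) at 2 by lra.
      apply Hb. rewrite Rabs_pos_eq; lra.
  - rewrite (Rabs_left a Ha) in *.
    replace (g a - g 0) with (g (- - a) - g (- 0)) by (rewrite Ropp_0, Ropp_involutive; ring).
    apply (increment_le_exp_pos (fun s => g (- s)) (fun s => - g' (- s))); [exact Hl|lra| |].
    + intros s Hs.
      replace (- g' (- s)) with (scal (-1) (g' (- s))) by (unfold scal; simpl; unfold mult; simpl; ring).
      apply (is_derive_comp g (fun s => - s)).
      * apply Hg. rewrite Rabs_Ropp, Rabs_pos_eq; lra.
      * auto_derive; trivial.
    + intros s Hs. rewrite Rabs_Ropp. rewrite <- (Rabs_pos_eq s) at 2 by lra.
      rewrite <- (Rabs_Ropp s). apply Hb. rewrite Rabs_Ropp, Rabs_pos_eq; lra.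
Qed.

Lemma increment_le (g g' : R -> R) (K a : R) :
  (forall s, Rabs s <= Rabs a -> is_derive g s (g' s)) ->
  (forall s, Rabs s <= Rabs a -> Rabs (g' s) <= K) ->
  Rabs (g a - g 0) <= K * Rabs a.
Proof.
  intros Hg Hb.
  assert (Hs : forall s, Rmin 0 a <= s <= Rmax 0 a -> Rabs s <= Rabs a).
  { intros s [H1 H2].
    destruct (Rle_or_lt 0 a).
    - rewrite Rmin_left in H1 by lra. rewrite Rmax_right in H2 by lra.
      rewrite !Rabs_pos_eq; lra.
    - rewrite Rmin_right in H1 by lra. rewrite Rmax_left in H2 by lra.
      rewrite (Rabs_left1 s), (Rabs_left1 a); lra. }
  destruct (MVT_gen g 0 a g') as [c [Hc ->]].
  - intros s Hs'. apply Hg, Hs; lra.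
  - intros s Hs'. apply derivable_continuous_pt. exists (g' s).
    apply is_derive_Reals, Hg, Hs, Hs'.
  - rewrite Rminus_0_r, Rabs_mult.
    apply Rmult_le_compat_r; [apply Rabs_pos|]. apply Hb, Hs, Hc.
Qed.

(** The second difference of [v] over the characteristic rectangle.  The function
    [p = v_x + v_t] is [v_xi], and its derivative in [eta] is
    [v_xx - v_xt + v_tx - v_tt], in which the mixed terms cancel.  So the mean
    value theorem in [eta] bounds [p (xi, eta) - p (xi, 0)], and integrating
    that bound in [xi] gives the claim. *)
Lemma goursat_rectangle (b : R) (v vx vt vxx vxt vtx vtt : R -> R -> R) (K lam xi eta : R) :
  0 < lam ->
  (forall x t, open_square b x t -> is_derive (fun y => v y t) x (vx x t)) ->
  (forall x t, open_square b x t -> is_derive (fun s => v x s) t (vt x t)) ->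
  (forall x t, open_square b x t -> is_derive (fun y => vx y t) x (vxx x t)) ->
  (forall x t, open_square b x t -> is_derive (fun s => vx x s) t (vxt x t)) ->
  (forall x t, open_square b x t -> is_derive (fun y => vt y t) x (vtx x t)) ->
  (forall x t, open_square b x t -> is_derive (fun s => vt x s) t (vtt x t)) ->
  (forall x t, open_square b x t -> continuity_2d_pt vx x t) ->
  (forall x t, open_square b x t -> continuity_2d_pt vxx x t) ->
  (forall x t, open_square b x t -> continuity_2d_pt vxt x t) ->
  (forall x t, open_square b x t -> continuity_2d_pt vtx x t) ->
  (forall x t, open_square b x t ->
    Rabs (vxx x t - vtt x t) <= K * exp (lam * Rabs ((x + t) / 2))) ->
  Rabs xi + Rabs eta < b ->
  Rabs (v (xi + eta) (xi - eta) - v xi xi - v eta (- eta) + v 0 0)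
    <= b * (K * (exp (lam * Rabs xi) - 1) / lam).
Proof.
  intros Hl Dx Dt Dxx Dxt Dtx Dtt Cx Cxx Cxt Ctx HK Hb.
  assert (HSq : forall r s, Rabs r + Rabs s < b -> open_square b (r + s) (r - s)).
  { intros r s H. split.
    - eapply Rle_lt_trans; [apply Rabs_triang|lra].
    - unfold Rminus. eapply Rle_lt_trans; [apply Rabs_triang|rewrite Rabs_Ropp; lra]. }
  set (p := fun x t => vx x t + vt x t).
  assert (Hp : forall r, Rabs r <= Rabs xi ->
    Rabs (p (r + eta) (r - eta) - p r r) <= K * exp (lam * Rabs r) * Rabs eta).
  { intros r Hr.
    assert (E := increment_le (fun s => p (r + s * 1) (r + s * -1))
      (fun s => vxx (r + s) (r - s) - vtt (r + s) (r - s))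
      (K * exp (lam * Rabs r)) eta).
    cbv beta in E.
    replace (r + eta * 1) with (r + eta) in E by ring.
    replace (r + eta * -1) with (r - eta) in E by ring.
    replace (r + 0 * 1) with r in E by ring.
    replace (r + 0 * -1) with r in E by ring.
    apply E.
    - intros s Hs.
      assert (Hq : open_square b (r + s) (r - s)) by (apply HSq; lra).
      replace (vxx (r + s) (r - s) - vtt (r + s) (r - s)) with
        ((vxx (r + s * 1) (r + s * -1) * 1 + vxt (r + s * 1) (r + s * -1) * -1) +
         (vtx (r + s * 1) (r + s * -1) * 1 + vtt (r + s * 1) (r + s * -1) * -1)).
      + replace (r + s) with (r + s * 1) in Hq by ring.
        replace (r - s) with (r + s * -1) in Hq by ring.
        apply @is_derive_plus.
        * apply (derive_along_line b vx vxx vxt); auto.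
        * apply (derive_along_line b vt vtx vtt); auto.
      + replace (r + s * 1) with (r + s) by ring.
        replace (r + s * -1) with (r - s) by ring.
        rewrite (mixed_derivatives_agree b v vx vt vxt vtx (r + s) (r - s)); auto. ring.
    - intros s Hs.
      replace r with ((r + s + (r - s)) / 2) at 5 by field.
      apply HK, HSq. lra. }
  assert (E := increment_le_exp
    (fun r => v (eta + r * 1) (- eta + r * 1) - v (0 + r * 1) (0 + r * 1))
    (fun r => p (r + eta) (r - eta) - p r r) (K * Rabs eta) lam xi Hl).
  cbv beta in E.
  replace (v (xi + eta) (xi - eta) - v xi xi - v eta (- eta) + v 0 0) with
    (v (eta + xi * 1) (- eta + xi * 1) - v (0 + xi * 1) (0 + xi * 1) -
        (v (eta + 0 * 1) (- eta + 0 * 1) - v (0 + 0 * 1) (0 + 0 * 1))).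
  2:{ rewrite !Rmult_0_l, !Rmult_1_r, !Rplus_0_r, !Rplus_0_l.
      rewrite (Rplus_comm eta), (Rplus_comm (- eta)). unfold Rminus. ring. }
  eapply Rle_trans; [apply E|].
  - intros r Hr.
    replace (p (r + eta) (r - eta) - p r r) with
      ((vx (eta + r * 1) (- eta + r * 1) * 1 + vt (eta + r * 1) (- eta + r * 1) * 1) -
       (vx (0 + r * 1) (0 + r * 1) * 1 + vt (0 + r * 1) (0 + r * 1) * 1)).
    + apply @is_derive_minus; apply (derive_along_line b v vx vt); auto.
      * replace (eta + r * 1) with (r + eta) by ring.
        replace (- eta + r * 1) with (r - eta) by ring. apply HSq. lra.
      * pose proof (Rabs_pos eta). split; rewrite Rmult_1_r, Rplus_0_l; lra.
    + unfold p. rewrite !Rmult_1_r, !Rplus_0_l.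
      rewrite (Rplus_comm eta), (Rplus_comm (- eta)). unfold Rminus. ring.
  - intros r Hr. eapply Rle_trans; [apply Hp, Hr|]. right; ring.
  - assert (HK0 : 0 <= K).
    { pose proof (Rabs_pos xi). pose proof (Rabs_pos eta).
      assert (Horig : open_square b 0 0) by (split; rewrite Rabs_R0; lra).
      specialize (HK 0 0 Horig).
      pose proof (Rabs_pos (vxx 0 0 - vtt 0 0)).
      pose proof (exp_pos (lam * Rabs ((0 + 0) / 2))). nra. }
    pose proof (Rabs_pos xi) as Hxi.
    assert (1 <= exp (lam * Rabs xi)).
    { rewrite <- exp_0. destruct (Req_dec (lam * Rabs xi) 0) as [->|Hn]; [lra|].
      left; apply exp_increasing. assert (0 <= lam * Rabs xi) by nra. lra. }
    replace (K * Rabs eta * (exp (lam * Rabs xi) - 1) / lam)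
      with (Rabs eta * (K * (exp (lam * Rabs xi) - 1) / lam)) by (field; lra).
    apply Rmult_le_compat_r; [|lra].
    apply Rdiv_le_0_compat; [|lra]. apply Rmult_le_pos; lra.
Qed.

(** * Continuous dependence on the Goursat data *)

Lemma continuous_square_ball (b : R) (v : R -> R -> C) (x t : R) (eps : posreal) :
  continuous_square b v -> seg b x -> seg b t ->
  exists d : posreal, forall y s, seg b y -> seg b s ->
    Rabs (y - x) < d -> Rabs (s - t) < d -> Cmod (v y s - v x t)%C < eps.
Proof.
  intros Cv Hx Ht. specialize (Cv (x, t) (conj Hx Ht)).
  assert (FF : Filter (within (square b)
    (locally (T := prod_UniformSpace R_UniformSpace R_UniformSpace) (x, t))))
    by apply within_filter, locally_filter.
  rewrite (filterlim_Cmod _ _ _) in Cv. destruct (Cv eps) as [d Hd].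
  exists d. intros y s Hy Hs Dy Ds.
  exact (Hd (y, s) (conj Dy Ds) (conj Hy Hs)).
Qed.

(** The chosen radius at a point also carries the bound: it is small enough that
    its inverse bounds [v] on the ball.  The inverse of the uniform lower bound
    on radii given by compactness is then a bound for [v]. *)
Lemma continuous_square_bounded (b : R) (v : R -> R -> C) :
  continuous_square b v ->
  exists B, 0 < B /\ forall x t, seg b x -> seg b t -> Cmod (v x t) <= B.
Proof.
  intros Cv.
  assert (Hloc : forall p : R * R, exists d : posreal, square b p ->
    forall y s, seg b y -> seg b s -> Rabs (y - fst p) < d -> Rabs (s - snd p) < d ->
    Cmod (v y s) <= / d).
  { intros [x t].
    destruct (classic (square b (x, t))) as [[Hx Ht]|Hn];
      [|exists (mkposreal 1 Rlt_0_1); intros H; now elim Hn].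
    destruct (continuous_square_ball b v x t (mkposreal 1 Rlt_0_1) Cv Hx Ht) as [d Hd].
    simpl in Hx, Ht, Hd. pose proof (Cmod_ge_0 (v x t)) as Hm.
    assert (H1 : 0 < / (Cmod (v x t) + 1)) by (apply Rinv_0_lt_compat; lra).
    assert (H2 : 0 < Rmin d (/ (Cmod (v x t) + 1))).
    { apply Rmin_glb_lt; [apply cond_pos|exact H1]. }
    exists (mkposreal _ H2). simpl. intros _ y s Hy Hs Dy Ds.
    pose proof (Rmin_l d (/ (Cmod (v x t) + 1))).
    pose proof (Rmin_r d (/ (Cmod (v x t) + 1))) as H3.
    assert (H4 := Hd y s Hy Hs ltac:(lra) ltac:(lra)).
    apply (Rinv_le_contravar _ _ H2) in H3. rewrite Rinv_inv in H3.
    eapply Rle_trans; [|exact H3].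
    pose proof (Cmod_triangle (v y s - v x t) (v x t)) as H5.
    replace (v y s - v x t + v x t)%C with (v y s) in H5 by ring. lra. }
  set (delta := fun p => proj1_sig (constructive_indefinite_description _ (Hloc p))).
  assert (Hdelta := fun p => proj2_sig (constructive_indefinite_description _ (Hloc p))).
  destruct (compactness_value_2d (- b) b (- b) b (fun x t => delta (x, t))) as [d Hd].
  exists (/ d). split; [apply Rinv_0_lt_compat, cond_pos|].
  intros x t Hx Ht. apply Rnot_lt_le. intros Hlt.
  apply (Hd x t Hx Ht). intros (y & s & Hy & Hs & Dy & Ds & Hle).
  assert (H : Cmod (v x t) <= / delta (y, s))
    by exact (Hdelta (y, s) (conj Hy Hs) x t Hx Ht Dy Ds).
  assert (/ delta (y, s) <= / d) by (apply Rinv_le_contravar; [apply cond_pos|exact Hle]).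
  lra.
Qed.

(** The mean value theorem is for real functions, so the rectangle estimate is
    applied to the images of a complex solution under real and imaginary
    part. *)
Definition contracting_functional (pi : C -> R) : Prop :=
  (forall z w, pi (z - w)%C = pi z - pi w) /\
  (forall r z, pi (RtoC r * z)%C = r * pi z) /\
  (forall z, Rabs (pi z) <= Cmod z).

Lemma Re_contracting : contracting_functional Re.
Proof.
  split; [|split].
  - intros [z1 z2] [w1 w2]. simpl. ring.
  - intros r [z1 z2]. simpl. ring.
  - apply re_le_Cmod.
Qed.

Lemma Im_contracting : contracting_functional Im.
Proof.
  split; [|split].
  - intros [z1 z2] [w1 w2]. simpl. ring.
  - intros r [z1 z2]. simpl. ring.
  - intros z. eapply Rle_trans; [apply Rmax_r|apply Rmax_Cmod].
Qed.

Lemma open_square_seg (b x t : R) : open_square b x t -> seg b x /\ seg b t.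
Proof.
  intros [Hx Ht]. apply Rabs_def2 in Hx, Ht. unfold seg. lra.
Qed.

Lemma functional_derive (b : R) (pi : C -> R) (g : R -> C) (x : R) (l : C) :
  contracting_functional pi -> Rabs x < b ->
  is_derive_within (seg b) g x l -> is_derive (fun y => pi (g y)) x (pi l).
Proof.
  intros (Hsub & Hscal & Hle) Hx Hg.
  assert (Hx' : seg b x) by (apply Rabs_def2 in Hx; unfold seg; lra).
  apply is_derive_within_slope in Hg; [|exact Hx'].
  destruct Hg as [h [Lh Hh]].
  assert (FF : Filter (within (seg b) (locally x))) by apply within_filter, locally_filter.
  rewrite (filterlim_Cmod _ h l) in Lh.
  apply is_derive_Reals. intros eps Heps.
  destruct (Lh (mkposreal eps Heps)) as [d Hd]. simpl in Hd.
  assert (Hd' : 0 < Rmin d (b - Rabs x)).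
  { apply Rmin_glb_lt; [apply cond_pos|lra]. }
  exists (mkposreal _ Hd'). simpl. intros k Hk0 Hk.
  pose proof (Rmin_l d (b - Rabs x)). pose proof (Rmin_r d (b - Rabs x)).
  assert (Hs : seg b (x + k)).
  { assert (Hb : Rabs (x + k) < b) by (eapply Rle_lt_trans; [apply Rabs_triang|lra]).
    apply Rabs_def2 in Hb. unfold seg. lra. }
  replace ((pi (g (x + k)) - pi (g x)) / k - pi l) with (pi (h (x + k)%R - l)%C).
  - eapply Rle_lt_trans; [apply Hle|]. apply Hd; [|exact Hs].
    change (Rabs (x + k - x) < d). replace (x + k - x) with k by ring. lra.
  - rewrite <- Hsub, (Hh _ Hs).
    replace (g x + RtoC (x + k - x) * h (x + k)%R - g x)%C
      with (RtoC k * h (x + k)%R)%C.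
    + rewrite Hscal, Hsub. field. exact Hk0.
    + replace (x + k - x) with k by ring. ring.
Qed.

Lemma functional_continuity (b : R) (pi : C -> R) (v : R -> R -> C) (x t : R) :
  contracting_functional pi -> continuous_square b v -> open_square b x t ->
  continuity_2d_pt (fun x t => pi (v x t)) x t.
Proof.
  intros (Hsub & _ & Hle) Cv Hxt eps.
  destruct (open_square_seg _ _ _ Hxt) as [Hx Ht].
  destruct (continuous_square_ball b v x t eps Cv Hx Ht) as [d1 H1].
  destruct (open_square_near _ _ _ Hxt) as [d2 H2].
  assert (Hd : 0 < Rmin d1 d2) by (apply Rmin_glb_lt; apply cond_pos).
  exists (mkposreal _ Hd). simpl. intros y s Hy Hs.
  pose proof (Rmin_l d1 d2). pose proof (Rmin_r d1 d2).
  destruct (open_square_seg b y s) as [Sy Ss]; [apply H2; lra|].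
  rewrite <- Hsub. eapply Rle_lt_trans; [apply Hle|]. apply H1; auto; lra.
Qed.

Lemma half_sum_diff_lt (b x t : R) : open_square b x t ->
  Rabs ((x + t) / 2) + Rabs ((x - t) / 2) < b.
Proof.
  intros [Hx Ht]. apply Rabs_def2 in Hx, Ht.
  unfold Rabs. destruct (Rcase_abs ((x + t) / 2)), (Rcase_abs ((x - t) / 2)); lra.
Qed.

Lemma goursat_functional (b : R) (q : R -> C) (w : R -> R -> C) (pi : C -> R)
  (Q A lam x t : R) :
  0 < lam -> 0 <= Q ->
  is_regular_wave_solution b q w -> contracting_functional pi ->
  (forall x, seg b x -> Cmod (q x) <= Q) ->
  (forall x t, open_square b x t ->
     Cmod (w x t) <= A * exp (lam * Rabs ((x + t) / 2))) ->
  open_square b x t ->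
  Rabs (pi (w x t) - pi (w ((x + t) / 2) ((x + t) / 2))
    - pi (w ((x - t) / 2) (- ((x - t) / 2))) + pi (w 0 0))
  <= b * (Q * A * (exp (lam * Rabs ((x + t) / 2)) - 1) / lam).
Proof.
  intros Hl HQ (wx & wt & wxx & wxt & wtx & wtt & D1 & D2 & D3 & D4 & D5 & D6
    & C1 & C2 & C3 & C4 & C5 & C6 & C7 & E) Hpi Hq Hw Hxt.
  assert (H := goursat_rectangle b (fun x t => pi (w x t)) (fun x t => pi (wx x t))
    (fun x t => pi (wt x t)) (fun x t => pi (wxx x t)) (fun x t => pi (wxt x t))
    (fun x t => pi (wtx x t)) (fun x t => pi (wtt x t)) (Q * A) lam
    ((x + t) / 2) ((x - t) / 2) Hl).
  cbv beta in H.
  replace ((x + t) / 2 + (x - t) / 2) with x in H by field.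
  replace ((x + t) / 2 - (x - t) / 2) with t in H by field.
  assert (Dx : forall v vx, is_pderiv_x b v vx -> forall x t, open_square b x t ->
    is_derive (fun y => pi (v y t)) x (pi (vx x t))).
  { intros v vx Hv y s Hys. destruct (open_square_seg _ _ _ Hys) as [Sy Ss].
    apply (functional_derive b pi (fun y => v y s)); [exact Hpi|apply Hys|now apply Hv]. }
  assert (Dt : forall v vt, is_pderiv_t b v vt -> forall x t, open_square b x t ->
    is_derive (fun s => pi (v x s)) t (pi (vt x t))).
  { intros v vt Hv y s Hys. destruct (open_square_seg _ _ _ Hys) as [Sy Ss].
    apply (functional_derive b pi (fun s => v y s)); [exact Hpi|apply Hys|now apply Hv]. }
  assert (Cc : forall v, continuous_square b v -> forall x t, open_square b x t ->
    continuity_2d_pt (fun x t => pi (v x t)) x t).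
  { intros v Cv y s Hys. now apply (functional_continuity b). }
  apply H; clear H.
  - exact (Dx _ _ D1).
  - exact (Dt _ _ D2).
  - exact (Dx _ _ D3).
  - exact (Dt _ _ D4).
  - exact (Dx _ _ D5).
  - exact (Dt _ _ D6).
  - exact (Cc _ C2).
  - exact (Cc _ C4).
  - exact (Cc _ C5).
  - exact (Cc _ C6).
  - intros y s Hys. destruct (open_square_seg _ _ _ Hys) as [Sy Ss].
    destruct Hpi as (Hsub & _ & Hle). rewrite <- Hsub.
    eapply Rle_trans; [apply Hle|].
    replace (wxx y s - wtt y s)%C with (q y * w y s)%C.
    + rewrite Cmod_mult, Rmult_assoc.
      apply Rmult_le_compat; auto using Cmod_ge_0.
    + specialize (E y s Sy Ss).
      replace (wxx y s - wtt y s)%C with (wxx y s - wtt y s - q y * w y s + q y * w y s)%C by ring.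
      rewrite E. ring.
  - now apply half_sum_diff_lt.
Qed.

Lemma Cmod_le_Re_Im (z : C) : Cmod z <= Rabs (Re z) + Rabs (Im z).
Proof.
  destruct z as [x y]. unfold Cmod. simpl.
  pose proof (Rabs_pos x). pose proof (Rabs_pos y).
  rewrite <- (sqrt_pow2 (Rabs x + Rabs y)) by lra.
  apply sqrt_le_1_alt.
  assert (x * x = Rabs x * Rabs x) by (rewrite <- Rabs_mult, Rabs_pos_eq; nra).
  assert (y * y = Rabs y * Rabs y) by (rewrite <- Rabs_mult, Rabs_pos_eq; nra).
  nra.
Qed.

(** One pass through the integral inequality.  With the weight exponent
    [lam = 4 Q b] the rectangle contributes at most [A / 4] times the weight to
    each of the real and imaginary parts, and the three corners on the axes
    contribute [3 delta]. *)
Lemma goursat_halving (b : R) (q : R -> C) (w : R -> R -> C) (Q A delta : R) :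
  0 < b -> 0 < Q -> 0 <= A -> 0 <= delta ->
  is_regular_wave_solution b q w ->
  (forall x, seg b x -> Cmod (q x) <= Q) ->
  (forall x, seg b x -> Cmod (w x x) <= delta /\ Cmod (w x (- x)) <= delta) ->
  (forall x t, open_square b x t ->
     Cmod (w x t) <= A * exp (4 * Q * b * Rabs ((x + t) / 2))) ->
  forall x t, open_square b x t ->
     Cmod (w x t) <= (6 * delta + A / 2) * exp (4 * Q * b * Rabs ((x + t) / 2)).
Proof.
  intros Hb HQ HA Hdelta Hw Hq Hdata Hbd x t Hxt.
  assert (Hl : 0 < 4 * Q * b) by (apply Rmult_lt_0_compat; lra).
  pose proof (half_sum_diff_lt b x t Hxt) as Hs.
  pose proof (Rabs_pos ((x + t) / 2)) as P1. pose proof (Rabs_pos ((x - t) / 2)) as P2.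
  assert (Sxi : seg b ((x + t) / 2)).
  { assert (H : Rabs ((x + t) / 2) < b) by lra. apply Rabs_def2 in H. unfold seg. lra. }
  assert (Seta : seg b ((x - t) / 2)).
  { assert (H : Rabs ((x - t) / 2) < b) by lra. apply Rabs_def2 in H. unfold seg. lra. }
  assert (S0 : seg b 0) by (unfold seg; lra).
  set (E := exp (4 * Q * b * Rabs ((x + t) / 2))).
  assert (HE : 1 <= E).
  { pose proof (exp_ineq1_le (4 * Q * b * Rabs ((x + t) / 2))) as H.
    assert (0 <= 4 * Q * b * Rabs ((x + t) / 2)) by (apply Rmult_le_pos; lra).
    unfold E. lra. }
  assert (Hpi : forall pi, contracting_functional pi ->
    Rabs (pi (w x t)) <= 3 * delta + A / 4 * E).
  { intros pi Hpi.
    assert (H := goursat_functional b q w pi Q A (4 * Q * b) x t Hl (Rlt_le _ _ HQ)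
      Hw Hpi Hq Hbd Hxt).
    fold E in H.
    replace (b * (Q * A * (E - 1) / (4 * Q * b))) with (A / 4 * (E - 1)) in H
      by (field; lra).
    destruct Hpi as (_ & _ & Hle).
    pose proof (Rle_trans _ _ _ (Hle _) (proj1 (Hdata _ Sxi))) as H1.
    pose proof (Rle_trans _ _ _ (Hle _) (proj2 (Hdata _ Seta))) as H2.
    pose proof (Rle_trans _ _ _ (Hle _) (proj1 (Hdata _ S0))) as H3.
    apply Rabs_le_between in H, H1, H2, H3. apply Rabs_le. lra. }
  eapply Rle_trans; [apply Cmod_le_Re_Im|].
  pose proof (Hpi _ Re_contracting). pose proof (Hpi _ Im_contracting).
  nra.
Qed.

(** [12 delta] is the fixed point of [A |-> 6 delta + A / 2], and iterating from
    any bound of [w] converges to it. *)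
Lemma goursat_stability_open (b : R) (q : R -> C) (w : R -> R -> C) (Q delta : R) :
  0 < b -> 0 < Q -> 0 <= delta ->
  is_regular_wave_solution b q w ->
  (forall x, seg b x -> Cmod (q x) <= Q) ->
  (forall x, seg b x -> Cmod (w x x) <= delta /\ Cmod (w x (- x)) <= delta) ->
  forall x t, open_square b x t ->
     Cmod (w x t) <= 12 * delta * exp (4 * Q * b * Rabs ((x + t) / 2)).
Proof.
  intros Hb HQ Hdelta Hw Hq Hdata.
  assert (HB : exists B, 0 < B /\ forall x t, seg b x -> seg b t -> Cmod (w x t) <= B).
  { apply continuous_square_bounded. apply regular_dalembert in Hw.
    destruct Hw as (? & ? & ? & ? & ? & ? & _ & [Cw _] & _). exact Cw. }
  destruct HB as (B & HB0 & HB).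
  assert (Hn : forall n x t, open_square b x t -> Cmod (w x t) <=
    (12 * delta + B * (/ 2) ^ n) * exp (4 * Q * b * Rabs ((x + t) / 2))).
  { induction n as [|n IH]; intros x t Hxt.
    - destruct (open_square_seg _ _ _ Hxt) as [Sx St].
      eapply Rle_trans; [now apply HB|]. simpl.
      pose proof (exp_ineq1_le (4 * Q * b * Rabs ((x + t) / 2))) as H.
      assert (0 <= 4 * Q * b * Rabs ((x + t) / 2)).
      { pose proof (Rabs_pos ((x + t) / 2)). apply Rmult_le_pos; [|lra].
        apply Rmult_le_pos; lra. }
      nra.
    - pose proof (pow_le (/ 2) n ltac:(lra)) as Hp.
      replace (12 * delta + B * (/ 2) ^ S n)
        with (6 * delta + (12 * delta + B * (/ 2) ^ n) / 2) by (simpl; field).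
      apply (goursat_halving b q w Q); auto. nra. }
  intros x t Hxt. apply le_epsilon. intros eps Heps.
  set (E := exp (4 * Q * b * Rabs ((x + t) / 2))).
  assert (HE : 0 < E) by apply exp_pos.
  assert (He : 0 < eps / (B * E)) by (apply Rdiv_lt_0_compat; [exact Heps|nra]).
  destruct (pow_lt_1_zero (/ 2) ltac:(rewrite Rabs_pos_eq; lra) _ He) as [n Hn'].
  specialize (Hn' n (le_n n)). specialize (Hn n x t Hxt). fold E in Hn.
  apply Rabs_def2 in Hn'. destruct Hn' as [Hn' _].
  apply (Rmult_lt_compat_r (B * E)) in Hn'; [|nra].
  unfold Rdiv in Hn'. rewrite Rmult_assoc, Rinv_l, Rmult_1_r in Hn' by nra.
  nra.
Qed.

(** Shrinking a point of the closed square towards the origin puts it in the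
    open square. *)
Lemma continuous_square_bound_closure (b : R) (w : R -> R -> C) (M : R) :
  0 < b -> continuous_square b w ->
  (forall x t, open_square b x t -> Cmod (w x t) <= M) ->
  forall x t, seg b x -> seg b t -> Cmod (w x t) <= M.
Proof.
  intros Hb Cw Hopen x t Hx Ht. apply le_epsilon. intros eps Heps.
  destruct (continuous_square_ball b w x t (mkposreal eps Heps) Cw Hx Ht) as [d Hd].
  simpl in Hd. pose proof (cond_pos d) as Hd0.
  set (e := Rmin (/ 2) (d / (2 * b))).
  assert (He0 : 0 < e).
  { unfold e. apply Rmin_glb_lt; [lra|]. apply Rdiv_lt_0_compat; lra. }
  assert (He1 : e <= / 2) by apply Rmin_l.
  assert (He2 : e * b <= d / 2).
  { apply Rle_trans with (d / (2 * b) * b); [apply Rmult_le_compat_r; [lra|apply Rmin_r]|].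
    right; field; lra. }
  assert (Hin : forall y, seg b y ->
    Rabs ((1 - e) * y) < b /\ Rabs ((1 - e) * y - y) < d).
  { intros y Hy. assert (Hy' : Rabs y <= b) by (apply Rabs_le; exact Hy).
    pose proof (Rabs_pos y). split.
    - rewrite Rabs_mult, (Rabs_pos_eq (1 - e)) by lra. nra.
    - replace ((1 - e) * y - y) with (- (e * y)) by ring.
      rewrite Rabs_Ropp, Rabs_mult, (Rabs_pos_eq e) by lra. nra. }
  destruct (Hin x Hx) as [Hx1 Hx2], (Hin t Ht) as [Ht1 Ht2].
  assert (Hsq : open_square b ((1 - e) * x) ((1 - e) * t)) by (split; assumption).
  destruct (open_square_seg _ _ _ Hsq) as [Sx St].
  specialize (Hd _ _ Sx St Hx2 Ht2). specialize (Hopen _ _ Hsq).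
  pose proof (Cmod_triangle (w ((1 - e) * x) ((1 - e) * t))
    (- (w ((1 - e) * x) ((1 - e) * t) - w x t))) as Htri.
  rewrite Cmod_opp in Htri.
  match type of Htri with Cmod ?z <= _ => replace z with (w x t) in Htri by ring end.
  lra.
Qed.

Theorem goursat_stability (b : R) (q : R -> C) :
  0 < b -> continuous_seg b q ->
  exists K, 0 < K /\ forall (w : R -> R -> C) (delta : R),
    is_regular_wave_solution b q w -> 0 <= delta ->
    (forall x, seg b x -> Cmod (w x x) <= delta /\ Cmod (w x (- x)) <= delta) ->
    forall x t, seg b x -> seg b t -> Cmod (w x t) <= K * delta.
Proof.
  intros Hb Cq.
  destruct (continuous_square_bounded b (fun x _ => q x)) as (Q & HQ & Hq);
    [now apply continuous_square_fst|].
  exists (12 * exp (4 * Q * b * b)). split; [pose proof (exp_pos (4 * Q * b * b)); lra|].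
  intros w delta Hw Hdelta Hdata.
  apply continuous_square_bound_closure; [exact Hb| |].
  { apply regular_dalembert in Hw.
    destruct Hw as (? & ? & ? & ? & ? & ? & _ & [Cw _] & _). exact Cw. }
  intros x t Hxt.
  assert (Hq' : forall x, seg b x -> Cmod (q x) <= Q) by (intros y Hy; now apply Hq with y).
  eapply Rle_trans; [now apply (goursat_stability_open b q w Q delta)|].
  rewrite (Rmult_comm (12 * exp _)), (Rmult_comm 12 delta), Rmult_assoc.
  apply Rmult_le_compat_l; [exact Hdelta|]. apply Rmult_le_compat_l; [lra|].
  pose proof (half_sum_diff_lt b x t Hxt). pose proof (Rabs_pos ((x - t) / 2)).
  assert (Hle : 4 * Q * b * Rabs ((x + t) / 2) <= 4 * Q * b * b).
  { apply Rmult_le_compat_l; [|lra]. apply Rmult_le_pos; lra. }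
  destruct Hle as [Hlt|Heq]; [left; now apply exp_increasing|rewrite Heq; lra].
Qed.

(** * Convergence of the wave polynomial expansion *)

Lemma wave_sum_diag (f : R -> C) (c beta : nat -> C) (N : nat) (x : R) :
  sum_n_m (fun n => c n * wave_poly f (2 * n - 1) x x + beta n * wave_poly f (2 * n) x x)%C 1 N
  = (sum_n_m (fun n => c n * wave_poly f (2 * n - 1) x x)%C 1 N
     + sum_n_m (fun n => beta n * wave_poly f (2 * n) x x)%C 1 N)%C.
Proof. exact (sum_n_m_plus (G := C_AbelianMonoid) _ _ 1 N). Qed.

Lemma wave_sum_antidiag (f : R -> C) (c beta : nat -> C) (N : nat) (x : R) :
  sum_n_m (fun n => c n * wave_poly f (2 * n - 1) x (- x)
                    + beta n * wave_poly f (2 * n) x (- x))%C 1 N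
  = (sum_n_m (fun n => c n * wave_poly f (2 * n - 1) x x)%C 1 N
     - sum_n_m (fun n => beta n * wave_poly f (2 * n) x x)%C 1 N)%C.
Proof.
  transitivity (sum_n_m (fun n => c n * wave_poly f (2 * n - 1) x x
      + RtoC (-1) * (beta n * wave_poly f (2 * n) x x))%C 1 N : C).
  - apply (sum_n_m_ext_loc (G := C_AbelianMonoid)). intros n [Hn _].
    rewrite wave_poly_odd_opp, wave_poly_even_opp by exact Hn. ring_C.
  - etransitivity; [exact (sum_n_m_plus (G := C_AbelianMonoid) _ _ 1 N)|].
    change (@plus C_AbelianMonoid) with Cplus. unfold Cminus. f_equal.
    etransitivity; [exact (sum_n_m_mult_l (K := C_Ring) (RtoC (-1)) _ 1 N)|].
    assert (E : forall z, (RtoC (-1) * z)%C = (- z)%C) by (intros z; ring).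
    exact (E _).
Qed.

Theorem proposition4p1
  (b : R) (hb : 0 < b)
  (q : R -> C) (hq : continuous_seg b q)
  (f : R -> C) (hf : is_C2_schrodinger_solution b q f)
  (hf_neq0 : forall x, seg b x -> f x <> RtoC 0)
  (hf0 : f 0 = RtoC 1)
  (u : R -> R -> C) (hu : is_regular_wave_solution b q u)
  (c beta : nat -> C)
  (hc : CVU_on (seg b)
    (fun N x => c 0%nat * wave_poly f 0 x x
       + sum_n_m (fun n => c n * wave_poly f (2 * n - 1) x x) 1 N)%C
    (fun x => RtoC (1 / 2) * (u x x + u x (- x)%R))%C)
  (hbeta : CVU_on (seg b)
    (fun N x => sum_n_m (fun n => beta n * wave_poly f (2 * n) x x)%C 1 N)
    (fun x => RtoC (1 / 2) * (u x x - u x (- x)%R))%C) :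
  (forall x t, seg b x -> seg b t ->
    filterlim
      (fun N => c 0%nat * wave_poly f 0 x t
         + sum_n_m (fun n => c n * wave_poly f (2 * n - 1) x t
                             + beta n * wave_poly f (2 * n) x t) 1 N)%C
      eventually (locally (u x t)))
  /\
  CVU_on (square b)
    (fun N p => c 0%nat * wave_poly f 0 (fst p) (snd p)
       + sum_n_m (fun n => c n * wave_poly f (2 * n - 1) (fst p) (snd p)
                           + beta n * wave_poly f (2 * n) (fst p) (snd p)) 1 N)%C
    (fun p => u (fst p) (snd p)).
Proof.
  set (S := fun N x t => (c 0%nat * wave_poly f 0 x t
    + sum_n_m (fun n => c n * wave_poly f (2 * n - 1) x t
                        + beta n * wave_poly f (2 * n) x t) 1 N)%C).
  assert (S_regular : forall N, is_regular_wave_solution b q (S N)).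
  { intros N. apply regular_comb; [now apply wave_poly_regular|].
    apply (regular_sum b q (fun n x t => c n * wave_poly f (2 * n - 1) x t
                        + beta n * wave_poly f (2 * n) x t)%C). intros n _.
    apply (regular_comb b q (c n) (wave_poly f (2 * n - 1))
      (fun x t => beta n * wave_poly f (2 * n) x t)%C);
      [now apply wave_poly_regular|].
    apply regular_scal. now apply wave_poly_regular. }
  destruct (goursat_stability b q hb hq) as (K & HK & Hstab).
  assert (Hunif : CVU_on (square b) (fun N p => S N (fst p) (snd p))
    (fun p => u (fst p) (snd p))).
  { intros eps Heps.
    assert (Hd : 0 < eps / (2 * K)) by (apply Rdiv_lt_0_compat; lra).
    destruct (hc (eps / (2 * K) / 2) ltac:(lra)) as [N1 H1].
    destruct (hbeta (eps / (2 * K) / 2) ltac:(lra)) as [N2 H2].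
    exists (max N1 N2). intros N HN [x t] [Hx Ht]. simpl in Hx, Ht |- *.
    (* The data are within [eps / (2 K)], which leaves [eps / 2] after stability. *)
    assert (Hle : Cmod (RtoC (-1) * u x t + S N x t)%C <= K * (eps / (2 * K))).
    { apply (Hstab (fun x t => RtoC (-1) * u x t + S N x t)%C); auto.
      - now apply regular_comb.
      - lra.
      - intros y Hy. specialize (H1 N ltac:(lia) y Hy). specialize (H2 N ltac:(lia) y Hy).
        cbv beta in H1, H2. unfold S.
        rewrite wave_sum_diag, wave_sum_antidiag.
        change (wave_poly f 0 y (- y)) with (wave_poly f 0 y y).
        set (A := sum_n_m (fun n => c n * wave_poly f (2 * n - 1) y y)%C 1 N : C) in *.
        set (B := sum_n_m (fun n => beta n * wave_poly f (2 * n) y y)%C 1 N : C) in *.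
        (* [a] and [d] are the remainders of the two given series, and the difference
           of the solutions is [a + d] at [(y, y)] and [a - d] at [(y, -y)]. *)
        set (a := (c 0%nat * wave_poly f 0 y y + A - RtoC (1 / 2) * (u y y + u y (- y)%R))%C) in *.
        set (d := (B - RtoC (1 / 2) * (u y y - u y (- y)%R))%C) in *.
        assert (Ehalf : (RtoC (1 / 2) + RtoC (1 / 2))%C = RtoC 1).
        { rewrite <- RtoC_plus. f_equal. field. }
        split.
        + match goal with |- Cmod ?z <= _ => replace z with (a + d)%C end.
          * eapply Rle_trans; [apply Cmod_triangle|lra].
          * unfold a, d.
            transitivity (c 0%nat * wave_poly f 0 y y + A + B
              - (RtoC (1 / 2) + RtoC (1 / 2)) * u y y)%C; [ring|rewrite Ehalf; ring].
        + match goal with |- Cmod ?z <= _ => replace z with (a - d)%C end.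
          * unfold Cminus. eapply Rle_trans; [apply Cmod_triangle|].
            rewrite Cmod_opp. lra.
          * unfold a, d.
            transitivity (c 0%nat * wave_poly f 0 y y + A - B
              - (RtoC (1 / 2) + RtoC (1 / 2)) * u y (- y)%R)%C; [ring|rewrite Ehalf; ring]. }
    replace (S N x t - u x t)%C with (RtoC (-1) * u x t + S N x t)%C
      by ring.
    replace (K * (eps / (2 * K))) with (eps / 2) in Hle by (field; lra). lra. }
  split; [|exact Hunif].
  intros x t Hx Ht.
  apply (filterlim_Cmod eventually (fun N => S N x t) (u x t)).
  intros eps. destruct (Hunif eps (cond_pos eps)) as [N HN].
  exists N. intros n Hn. exact (HN n Hn (x, t) (conj Hx Ht)).
Qed.
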